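(* Let $D\subset\mathbb{C}$ be open and symmetric with respect to the real axis, and let $f(x_0+\underline x)=\alpha(x_0,r)+\underline\omega\,\beta(x_0,r)$, $r=|\underline x|$, be a slice regular function on $\Omega_D\subset\mathbb{R}^{m+1}$. For $n\in\mathbb{N}\cup\{0\}$ define on $\Omega_D\setminus\mathbb{R}$ $$\mathcal{V}_nf=\left(\frac1r\partial_r\right)^n\alpha(x_0,r)+\underline\omega\left(\partial_r\frac1r\right)^n\beta(x_0,r).$$ Then for every $n\in\mathbb{N}\cup\{0\}$ and every normalized root system $\mathscr{R}\subset\mathbb{R}^m$ with multiplicity function $\kappa\notin K^{\rm sing}$ satisfying $\gamma_\kappa=n+\frac{1-m}{2}$, $$\mathcal{V}_nf\in\ker D_\kappa .$$ In other words, for a fixed root system $\mathscr{R}\subset\mathbb{R}^m$ with positive multiplicity function $\kappa$ such that $\gamma_\kappa+\frac{m-1}{2}\in\mathbb{N}\cup\{0\}$, $$\mathcal{V}_nf\in\begin{cases}\ker\overline\partial_x, & n=(m-1)/2\in\mathbb{N},\\ \ker D_\kappa, & n=\gamma_\kappa+(m-1)/2\in\mathbb{N}.\end{cases}$$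
   Context: Clifford algebra: $\mathbb{R}_{0,m}$ is the real universal Clifford algebra generated by $e_1,\dots,e_m$ with $e_je_k=-e_ke_j$ ($j\ne k$), $e_j^2=-1$. Vectors in $\mathbb{R}^m$ are identified with $\underline{x}=\sum_{j=1}^m x_je_j$ and $\mathbb{R}^{m+1}$ with the paravectors $x_0+\underline{x}$; $\underline\omega=\underline x/|\underline x|$. $\mathbb{S}^{m-1}$ is the unit sphere of $\mathbb{R}^m$. Scalar operators act componentwise on $\mathbb{R}_{0,m}$-valued functions. The operator $\partial_r\frac1r$ means $g\mapsto\partial_r(g/r)$. Root systems: $\sigma_{\underline\alpha}x=x-2\frac{\langle\underline\alpha,x\rangle}{|\underline\alpha|^2}\underline\alpha$. A root system is a finite set $\mathscr{R}\subset\mathbb{R}^m\setminus\{0\}$ (with $\mathbb{R}^m\subset\mathbb{R}^{m+1}$ the space of vectors, so $x_0$ is fixed by all reflections) with $\mathscr{R}\cap\mathbb{R}\underline\alpha=\{\pm\underline\alpha\}$ and $\sigma_{\underline\alpha}\mathscr{R}=\mathscr{R}$ for all $\underline\alpha\in\mathscr{R}$; normalized means $\langle\underline\alpha,\underline\alpha\rangle=2$ for all roots (all root systems here are normalized). $\mathscr{R}=\mathscr{R}_+\cup(-\mathscr{R}_+)$ is a disjoint union separated by a hyperplane through $0$, with $\mathscr{R}_+$ fixed. A multiplicity function $\kappa:\mathscr{R}\to\mathbb{R}$ is a function invariant under the finite group generated by the reflections $\sigma_{\underline\alpha}$; $\gamma_\kappa=\sum_{\underline\alpha\in\mathscr{R}_+}\kappa(\underline\alpha)$.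 Dunkl operators: $T_jf(x)=\partial_{x_j}f(x)+\sum_{\underline\alpha\in\mathscr{R}_+}\kappa(\underline\alpha)\frac{f(x)-f(\sigma_{\underline\alpha}x)}{\langle\underline\alpha,\underline x\rangle}\alpha_j$, $j=1,\dots,m$ (difference quotients extended by continuity to $\langle\underline\alpha,\underline x\rangle=0$), $T_0=\partial_{x_0}$; they commute. $K^{\rm sing}$ is the set of multiplicity functions $\kappa$ for which the bilinear form $[p,q]_\kappa=(p(T)q)(0)$ on polynomials is degenerate. The Dunkl-Cauchy-Riemann operator is $D_\kappa=\partial_{x_0}+\sum_{j=1}^m e_jT_j$; the generalized Cauchy-Riemann operator is $\overline\partial_x=\partial_{x_0}+\sum_{j=1}^m e_j\partial_{x_j}$. Kernels are understood on $\Omega_D\setminus\mathbb{R}$. Slice functions: $\Omega_D=\{a+\underline\omega b: a+ib\in D,\ \underline\omega\in\mathbb{S}^{m-1}\}$. A stem function is $F=\alpha+i\beta:D\to\mathbb{R}_{0,m}\otimes\mathbb{C}$ with $\alpha,\beta$ $\mathbb{R}_{0,m}$-valued, $\alpha(\bar z)=\alpha(z)$, $\beta(\bar z)=-\beta(z)$. A function $f:\Omega_D\to\mathbb{R}_{0,m}$ is slice regular if $f(x_0+\underline x)=\alpha(x_0,|\underline x|)+\underline\omega\,\beta(x_0,|\underline x|)$ for a stem function $F=\alpha+i\beta$ that is holomorphic, i.e. $\partial_s\alpha=\partial_t\beta$, $\partial_t\alpha=-\partial_s\beta$ in $z=s+it$. *)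

(* Defs.v *)
From HB Require Import structures.
From mathcomp Require Import all_boot all_order all_algebra finmap.
From mathcomp Require Import all_classical all_reals all_analysis.
From mathcomp Require mpoly.

Set Implicit Arguments.
Unset Strict Implicit.
Unset Printing Implicit Defensive.

Import Order.TTheory GRing.Theory Num.Theory.
Import numFieldNormedType.Exports.
Local Open Scope classical_set_scope.
Local Open Scope ring_scope.

(** An element of R_{0,m} is the family of its coordinates in the basis (e_A), A a subset of
  {0, .., m-1}, where e_A = e_{i_1} ... e_{i_k} for A = {i_1 < ... < i_k}.
  With e_i e_j = - e_j e_i for i <> j and e_i ^ 2 = -1, sorting the product
  e_A e_B gives (-1) ^ N e_{A (+) B}, where N counts the pairs (i, j) in A x B
  with j <= i: one transposition for each j < i and one square for each j = i. *)

Definition clifford (R : comNzRingType) (m : nat) : Type := {ffun {set 'I_m} -> R}.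

HB.instance Definition _ (R : comNzRingType) (m : nat) :=
  GRing.Lmodule.copy (clifford R m) {ffun {set 'I_m} -> R^o}.

Definition cl_coef (R : comNzRingType) (m : nat) (A : {set 'I_m})
  (a : clifford R m) : R := (a : {ffun {set 'I_m} -> R}) A.

Definition cl_mk (R : comNzRingType) (m : nat) (c : {set 'I_m} -> R) :
  clifford R m := [ffun A => c A].

Definition symdiff (m : nat) (A B : {set 'I_m}) : {set 'I_m} :=
  [set i | (i \in A) (+) (i \in B)]%SET.

Definition cl_inv (m : nat) (A B : {set 'I_m}) : nat :=
  (\sum_(i in A) #|[set j in B | (j <= i)%N]%SET|)%N.

Definition cl_mul (R : comNzRingType) (m : nat) (a b : clifford R m) :
    clifford R m :=
  cl_mk (fun C => \sum_(A : {set 'I_m}) \sum_(B : {set 'I_m} | symdiff A B == C)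
                    (-1) ^+ cl_inv A B * (cl_coef A a * cl_coef B b)).

Definition cl_basis (R : comNzRingType) (m : nat) (A : {set 'I_m}) :
  clifford R m := cl_mk (fun B => (B == A)%:R).

Section CliffordRing.
Context (R : comNzRingType) (m : nat).
Implicit Types (a b c : clifford R m) (A B C D : {set 'I_m}).

Lemma cl_mkE (f : {set 'I_m} -> R) A : cl_coef A (cl_mk f) = f A.
Proof. by rewrite /cl_coef /cl_mk ffunE. Qed.

Lemma cl_coefP a b : (forall A, cl_coef A a = cl_coef A b) -> a = b.
Proof. by move=> h; apply/ffunP. Qed.

Lemma cl_coefD A a b : cl_coef A (a + b) = cl_coef A a + cl_coef A b.
Proof. by rewrite /cl_coef ffunE. Qed.

Lemma cl_coefZ A (k : R) a : cl_coef A (k *: a) = k * cl_coef A a.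
Proof. by rewrite /cl_coef ffunE. Qed.

Lemma symdiffA : associative (@symdiff m).
Proof. by move=> A B C; apply/setP => i; rewrite !inE addbA. Qed.

Lemma symdiffK A : cancel (symdiff A) (symdiff A).
Proof. by move=> B; apply/setP => i; rewrite !inE addKb. Qed.

Lemma symdiff0s A : symdiff (finset.set0) A = A.
Proof. by apply/setP => i; rewrite !inE. Qed.

Lemma symdiffs0 A : symdiff A (finset.set0) = A.
Proof. by apply/setP => i; rewrite !inE addbF. Qed.

Lemma symdiffss A : symdiff A A = finset.set0.
Proof. by apply/setP => i; rewrite !inE addbb. Qed.

Lemma odd_cl_inv A B : odd (cl_inv A B) =
  \big[addb/false]_i \big[addb/false]_j [&& i \in A, j \in B & (j <= i)%N].
Proof.
rewrite /cl_inv (big_morph odd oddD (erefl : odd 0 = false)) big_mkcond /=.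
apply: eq_bigr => i _; case: ifP => iA; last by rewrite big1.
rewrite -sum1_card (big_morph odd oddD (erefl : odd 0 = false)) big_mkcond /=.
by apply: eq_bigr => j _; rewrite inE; case: ifP.
Qed.

Lemma odd_cl_invDl A B C :
  odd (cl_inv (symdiff A B) C) = odd (cl_inv A C) (+) odd (cl_inv B C).
Proof.
rewrite !odd_cl_inv -big_split; apply: eq_bigr => i _ /=.
rewrite -big_split; apply: eq_bigr => j _ /=; rewrite inE.
by case: (i \in A); case: (i \in B); case: (j \in C); case: leqP.
Qed.

Lemma odd_cl_invDr A B C :
  odd (cl_inv A (symdiff B C)) = odd (cl_inv A B) (+) odd (cl_inv A C).
Proof.
rewrite !odd_cl_inv -big_split; apply: eq_bigr => i _ /=.
rewrite -big_split; apply: eq_bigr => j _ /=; rewrite inE.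
by case: (i \in A); case: (j \in B); case: (j \in C); case: leqP.
Qed.

Lemma cl_inv0s A : cl_inv (finset.set0) A = 0%N.
Proof. by rewrite /cl_inv big_set0. Qed.

Lemma cl_invs0 A : cl_inv A (finset.set0) = 0%N.
Proof.
rewrite /cl_inv big1 // => i _; apply/eqP; rewrite cards_eq0.
by apply/eqP/setP => j; rewrite !inE.
Qed.

Lemma cl_mulE a b C : cl_coef C (cl_mul a b) =
  \sum_A (-1) ^+ cl_inv A (symdiff A C) * (cl_coef A a * cl_coef (symdiff A C) b).
Proof.
rewrite cl_mkE; apply: eq_bigr => A _; rewrite (big_pred1 (symdiff A C)) // => B.
by apply/eqP/eqP => [<-|->]; rewrite symdiffK.
Qed.

Lemma cl_mulA : associative (@cl_mul R m).
Proof.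
move=> a b c; apply: cl_coefP => D; rewrite !cl_mulE.
under [RHS]eq_bigr => E _ do rewrite cl_mulE mulr_suml mulr_sumr.
rewrite exchange_big /=; apply: eq_bigr => A _.
rewrite cl_mulE (reindex (symdiff A)) /=; last first.
  by exists (symdiff A) => B _; exact: symdiffK.
rewrite !mulr_sumr; apply: eq_bigr => E _.
have -> : symdiff (symdiff A E) (symdiff A D) = symdiff E D.
  by apply/setP => i; rewrite !inE; case: (i \in A); case: (i \in E); case: (i \in D).
have sgn : (-1) ^+ cl_inv A (symdiff A D) *
           (-1) ^+ cl_inv (symdiff A E) (symdiff E D) =
           (-1) ^+ cl_inv E (symdiff E D) * (-1) ^+ cl_inv A (symdiff A E) :> R.
  rewrite -!exprD -[LHS]signr_odd -[RHS]signr_odd !oddD.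
  rewrite odd_cl_invDl !odd_cl_invDr.
  congr (_ ^+ nat_of_bool _).
  by do 5!case: (odd _).
by rewrite mulrA mulrACA sgn -!mulrA.
Qed.

Lemma cl_mul_basis A B :
  cl_mul (cl_basis R A) (cl_basis R B) =
  (-1) ^+ cl_inv A B *: cl_basis R (symdiff A B).
Proof.
apply: cl_coefP => C; rewrite cl_mulE cl_coefZ cl_mkE (bigD1 A) //= big1.
  rewrite addr0 !cl_mkE eqxx mul1r.
  have -> : (symdiff A C == B) = (C == symdiff A B).
    by apply/eqP/eqP => [<-|->]; rewrite symdiffK.
  by case: eqP => [->|_]; rewrite ?mulr0 // symdiffK.
by move=> D /negbTE DA; rewrite !cl_mkE DA mul0r mulr0.
Qed.

Lemma cl_mul1l : left_id (cl_basis R finset.set0) (@cl_mul R m).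
Proof.
move=> a; apply: cl_coefP => C; rewrite cl_mulE (bigD1 finset.set0) //= big1.
  by rewrite addr0 cl_mkE eqxx mul1r cl_inv0s symdiff0s mul1r.
by move=> A /negbTE A0; rewrite cl_mkE A0 mul0r mulr0.
Qed.

Lemma cl_mul1r : right_id (cl_basis R finset.set0) (@cl_mul R m).
Proof.
move=> a; apply: cl_coefP => C; rewrite cl_mulE (bigD1 C) //= big1.
  by rewrite addr0 cl_mkE symdiffss eqxx mulr1 cl_invs0 mul1r.
move=> A AC; rewrite cl_mkE; case: eqP => [AC0|_]; last by rewrite !mulr0.
by move: AC; rewrite -(symdiffK A C) AC0 symdiffs0 eqxx.
Qed.

Lemma cl_mulDl : left_distributive (@cl_mul R m) +%R.
Proof.
move=> a b c; apply: cl_coefP => C; rewrite cl_coefD !cl_mulE -big_split.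
by apply: eq_bigr => A _; rewrite cl_coefD mulrDl mulrDr.
Qed.

Lemma cl_mulDr : right_distributive (@cl_mul R m) +%R.
Proof.
move=> a b c; apply: cl_coefP => C; rewrite cl_coefD !cl_mulE -big_split.
by apply: eq_bigr => A _; rewrite cl_coefD !mulrDr.
Qed.

Lemma cl_basis0_neq0 : cl_basis R (finset.set0 : {set 'I_m}) != 0 :> clifford R m.
Proof.
apply/eqP => /(congr1 (@cl_coef R m finset.set0)).
by rewrite cl_mkE eqxx /cl_coef ffunE; apply/eqP; exact: oner_neq0.
Qed.

Lemma cl_scaleAl (k : R) a b : k *: cl_mul a b = cl_mul (k *: a) b.
Proof.
apply: cl_coefP => C; rewrite cl_coefZ !cl_mulE mulr_sumr.
by apply: eq_bigr => A _; rewrite cl_coefZ -mulrA mulrCA.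
Qed.

Lemma cl_scaleAr (k : R) a b : k *: cl_mul a b = cl_mul a (k *: b).
Proof.
apply: cl_coefP => C; rewrite cl_coefZ !cl_mulE mulr_sumr.
by apply: eq_bigr => A _; rewrite cl_coefZ mulrCA; congr (_ * _); rewrite mulrCA.
Qed.

End CliffordRing.

HB.instance Definition _ (R : comNzRingType) (m : nat) :=
  GRing.Zmodule_isNzRing.Build (clifford R m) (@cl_mulA R m) (@cl_mul1l R m)
    (@cl_mul1r R m) (@cl_mulDl R m) (@cl_mulDr R m) (cl_basis0_neq0 R m).

HB.instance Definition _ (R : comNzRingType) (m : nat) :=
  GRing.Lmodule_isLalgebra.Build R (clifford R m) (@cl_scaleAl R m).

HB.instance Definition _ (R : comNzRingType) (m : nat) :=
  GRing.Lalgebra_isAlgebra.Build R (clifford R m) (@cl_scaleAr R m).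

Definition cl_gen (R : comNzRingType) (m : nat) (j : 'I_m) : clifford R m :=
  cl_basis R [set j]%SET.

Section CliffordRelations.
Context (R : comNzRingType) (m : nat).

Lemma cl_basisM (A B : {set 'I_m}) : cl_basis R A * cl_basis R B =
  (-1) ^+ cl_inv A B *: cl_basis R (symdiff A B).
Proof. exact: cl_mul_basis. Qed.

Lemma cl_inv11 (i j : 'I_m) : cl_inv [set i]%SET [set j]%SET = (j <= i)%N.
Proof.
rewrite /cl_inv big_set1; case: leqP => ij.
  rewrite -[RHS](cards1 j); apply: eq_card => k; rewrite !inE.
  by case: eqP => // ->.
apply/eqP; rewrite cards_eq0; apply/eqP/setP => k; rewrite !inE.
by case: eqP => // ->; rewrite leqNgt ij.
Qed.

Lemma cl_gen_sqr (j : 'I_m) : cl_gen R j * cl_gen R j = -1.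
Proof.
rewrite /cl_gen cl_basisM symdiffss cl_inv11 leqnn expr1.
exact: scaleN1r.
Qed.

Lemma cl_gen_anticomm (i j : 'I_m) :
  i != j -> cl_gen R i * cl_gen R j = - (cl_gen R j * cl_gen R i).
Proof.
move=> ij; rewrite /cl_gen !cl_basisM !cl_inv11.
have -> : symdiff [set j]%SET [set i]%SET = symdiff [set i]%SET [set j]%SET.
  by apply/setP => k; rewrite !inE addbC.
move: ij; rewrite -val_eqE /=; case: ltngtP => //= _ _;
  by rewrite ?expr0 ?expr1 ?scale1r ?scaleN1r ?opprK.
Qed.

Lemma cl_basis_prod (A : {set 'I_m}) :
  cl_basis R A = \prod_(j <- enum A) cl_gen R j.
Proof.
have gen (s : seq 'I_m) : sorted ltn [seq val j | j <- s] ->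
    \prod_(j <- s) cl_gen R j = cl_basis R [set j in s]%SET.
  elim: s => [|i s IHs] /=; first by rewrite big_nil => _; congr cl_basis; apply/setP => j; rewrite !inE.
  move=> ps; rewrite big_cons (IHs (path_sorted ps)) cl_basisM.
  have ltis j : j \in s -> (i < j)%N.
    move=> js; move: ps; rewrite (path_sortedE ltn_trans) => /andP[/allP + _].
    by apply; apply: map_f.
  have -> : cl_inv [set i]%SET [set j in s]%SET = 0%N.
    rewrite /cl_inv big_set1; apply/eqP; rewrite cards_eq0.
    apply/eqP/setP => j; rewrite !inE; apply/negbTE/negP => /andP[/ltis].
    by rewrite ltnNge => /negP.
  rewrite expr0 scale1r; congr cl_basis; apply/setP => j; rewrite !inE.
  by case: eqP => // ->; case: (boolP (i \in s)) => // /ltis; rewrite ltnn.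
rewrite gen; first by congr cl_basis; apply/setP => j; rewrite inE mem_enum.
apply: (subseq_sorted ltn_trans _ (iota_ltn_sorted 0 m)).
by rewrite -val_enum_ord map_subseq // enumT /enum_mem filter_subseq.
Qed.

End CliffordRelations.

(* The library norm on 'rV[R]_m is the sup norm, hence the Euclidean one here. *)
Definition dotv (R : realType) (m : nat) (x y : 'rV[R]_m) : R :=
  \sum_(j < m) x 0 j * y 0 j.

Definition enorm (R : realType) (m : nat) (x : 'rV[R]_m) : R :=
  Num.sqrt (dotv x x).

Definition cl_vec (R : realType) (m : nat) (x : 'rV[R]_m) : clifford R m :=
  \sum_(j < m) x 0 j *: cl_gen R j.

(* (x_0, x) stands for the paravector x_0 + x. *)
Notation paravec R m := (R * 'rV[R]_m)%type (only parsing).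

Definition dir0 (R : realType) (m : nat) : paravec R m := (1, 0).

Definition dirv (R : realType) (m : nat) (j : 'I_m) : paravec R m :=
  (0, delta_mx 0 j).

Definition cl_dir (R : realType) (m : nat) (x : 'rV[R]_m) : clifford R m :=
  cl_vec ((enorm x)^-1 *: x).

Definition cwise (R : realType) (m : nat) (X : Type) (T : (X -> R) -> (X -> R))
    (g : X -> clifford R m) : X -> clifford R m :=
  fun x => cl_mk (fun A => T (fun y => cl_coef A (g y)) x).

Definition refl (R : realType) (m : nat) (a x : 'rV[R]_m) : 'rV[R]_m :=
  x - (2 * dotv a x / enorm a ^+ 2) *: a.

Definition preflect (R : realType) (m : nat) (a : 'rV[R]_m) (x : paravec R m) :
  paravec R m := (x.1, refl a x.2).

Definition root_system (R : realType) (m : nat) (S : {fset 'rV[R]_m}) : Prop :=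
  0 \notin S /\
  forall a, a \in S ->
    (forall b, (b \in S /\ exists c : R, b = c *: a) <-> (b = a \/ b = - a)) /\
    [fset refl a b | b in S]%fset = S.

Definition normalized (R : realType) (m : nat) (S : {fset 'rV[R]_m}) : Prop :=
  forall a, a \in S -> dotv a a = 2.

Definition positive_subsystem (R : realType) (m : nat) (S P : {fset 'rV[R]_m}) :
    Prop :=
  [/\ (P `|` [fset - a | a in P])%fset = S,
      [disjoint P & [fset - a | a in P]]%fset
    & exists2 v : 'rV[R]_m, v != 0 & forall a, a \in P -> 0 < dotv v a].

(* A multiplicity function is only used on S, hence the total k. Elements of
   the reflection group are the finite products of reflections in roots. *)
Definition multiplicity (R : realType) (m : nat) (S : {fset 'rV[R]_m})
    (k : 'rV[R]_m -> R) : Prop :=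
  forall (s : seq 'rV[R]_m) (a : 'rV[R]_m),
    {subset s <= S} -> a \in S -> k (foldr (@refl R m) a s) = k a.

Definition gamma_k (R : realType) (m : nat) (P : {fset 'rV[R]_m})
  (k : 'rV[R]_m -> R) : R := \sum_(a <- P) k a.

Definition diff_quot (R : realType) (m : nat) (a : 'rV[R]_m)
    (f : paravec R m -> R) (x : paravec R m) : R :=
  (f x - f (preflect a x)) / dotv a x.2.

Definition off_mirror (R : realType) (m : nat) (a : 'rV[R]_m) (x : paravec R m) :=
  within [set y : paravec R m | dotv a y.2 != 0] (nbhs x).

(* Extension of diff_quot by continuity to the mirror <a, x> = 0. *)
Definition diff_quot_ext (R : realType) (m : nat) (a : 'rV[R]_m)
    (f : paravec R m -> R) (x : paravec R m) : R :=
  if dotv a x.2 == 0 then lim (diff_quot a f y @[y --> off_mirror a x])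
  else diff_quot a f x.

Definition dunkl (R : realType) (m : nat) (P : {fset 'rV[R]_m})
    (k : 'rV[R]_m -> R) (j : 'I_m) (f : paravec R m -> R) (x : paravec R m) : R :=
  'D_(dirv R j) f x + \sum_(a <- P) k a * diff_quot_ext a f x * a 0 j.

(* T^u = T_1^(u_1) ... T_m^(u_m); the order is immaterial as the T_j commute. *)
Definition dunkl_mon (R : realType) (m : nat) (P : {fset 'rV[R]_m})
    (k : 'rV[R]_m -> R) (u : mpoly.multinom m) (f : paravec R m -> R) :
    paravec R m -> R :=
  foldr (fun j g => iter (mpoly.fun_of_multinom u j) (dunkl P k j) g) f
    (enum 'I_m).

(* [p, q]_k = (p(T) q)(0), for polynomials in the coordinates of the vector
   part. *)
Definition dunkl_form (R : realType) (m : nat) (P : {fset 'rV[R]_m})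
    (k : 'rV[R]_m -> R) (p q : mpoly.mpoly m R) : R :=
  \sum_(u <- mpoly.msupp p) mpoly.mcoeff u p *
    dunkl_mon P k u (fun x => mpoly.meval (fun i => x.2 0 i) q) 0.

Definition K_sing (R : realType) (m : nat) (P : {fset 'rV[R]_m})
    (k : 'rV[R]_m -> R) : Prop :=
  exists2 p : mpoly.mpoly m R, p <> mpoly.mpolyC m 0 & forall q, dunkl_form P k p q = 0.

Definition dunkl_CR (R : realType) (m : nat) (P : {fset 'rV[R]_m})
    (k : 'rV[R]_m -> R) (g : paravec R m -> clifford R m) (x : paravec R m) :
    clifford R m :=
  cwise (fun h => 'D_(dir0 R m) h) g x +
  \sum_(j < m) cl_gen R j * cwise (dunkl P k j) g x.

Definition gen_CR (R : realType) (m : nat) (g : paravec R m -> clifford R m)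
    (x : paravec R m) : clifford R m :=
  cwise (fun h => 'D_(dir0 R m) h) g x +
  \sum_(j < m) cl_gen R j * cwise (fun h => 'D_(dirv R j) h) g x.

Definition partially_derivable (R : realType) (m : nat)
    (g : paravec R m -> clifford R m) (x : paravec R m) : Prop :=
  forall A, derivable (fun y => cl_coef A (g y)) x (dir0 R m) /\
    forall j : 'I_m, derivable (fun y => cl_coef A (g y)) x (dirv R j).

(* derive and lim are total with junk values, so being in a kernel includes the
   existence of the derivatives and of the extended difference quotients. *)
Definition in_ker_gen_CR (R : realType) (m : nat) (U : set (paravec R m))
    (g : paravec R m -> clifford R m) : Prop :=
  forall x, U x -> partially_derivable g x /\ gen_CR g x = 0.

Definition in_ker_dunkl_CR (R : realType) (m : nat) (P : {fset 'rV[R]_m})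
    (k : 'rV[R]_m -> R) (U : set (paravec R m))
    (g : paravec R m -> clifford R m) : Prop :=
  forall x, U x ->
    [/\ partially_derivable g x,
        forall a, a \in P -> dotv a x.2 = 0 -> forall A,
          cvg (diff_quot a (fun y => cl_coef A (g y)) y @[y --> off_mirror a x])
      & dunkl_CR P k g x = 0].

(** C is identified with R * R, and alpha + i beta with the pair (alpha, beta). *)

Definition conj_symmetric (R : realType) (D : set (R * R)) : Prop :=
  forall z, D z -> D (z.1, - z.2).

Definition Omega (R : realType) (m : nat) (D : set (R * R)) : set (paravec R m) :=
  [set x | exists a b (w : 'rV[R]_m), [/\ D (a, b), enorm w = 1 & x = (a, b *: w)]].

Definition real_line (R : realType) (m : nat) : set (paravec R m) :=
  [set x | x.2 = 0].
Arguments real_line : clear implicits.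

Definition stem (R : realType) (m : nat) (D : set (R * R))
    (alpha beta : R * R -> clifford R m) : Prop :=
  forall z, D z ->
    alpha (z.1, - z.2) = alpha z /\ beta (z.1, - z.2) = - beta z.

Definition d_s (R : realType) (m : nat) : (R * R -> clifford R m) ->
    (R * R -> clifford R m) :=
  cwise (fun h : R * R -> R => 'D_((1, 0) : R * R) h).

Definition d_t (R : realType) (m : nat) : (R * R -> clifford R m) ->
    (R * R -> clifford R m) :=
  cwise (fun h : R * R -> R => 'D_((0, 1) : R * R) h).

Definition holomorphic (R : realType) (m : nat) (D : set (R * R))
    (alpha beta : R * R -> clifford R m) : Prop :=
  forall z, D z ->
    [/\ forall A, differentiable (fun w => cl_coef A (alpha w) : R) z /\
                  differentiable (fun w => cl_coef A (beta w) : R) z,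
        d_s alpha z = d_t beta z
      & d_t alpha z = - d_s beta z].

(* f is slice regular on Omega D, with stem function alpha + i beta. At r = 0
   the stem condition gives beta = 0, so the value of cl_dir 0 is irrelevant. *)
Definition slice_regular (R : realType) (m : nat) (D : set (R * R))
    (alpha beta : R * R -> clifford R m) (f : paravec R m -> clifford R m) : Prop :=
  [/\ stem D alpha beta, holomorphic D alpha beta
    & forall x, Omega D x ->
        f x = alpha (x.1, enorm x.2) + cl_dir x.2 * beta (x.1, enorm x.2)].

Definition inv_r_d (R : realType) (g : R -> R) : R -> R :=
  fun r => r^-1 * derive1 g r.

Definition d_inv_r (R : realType) (g : R -> R) : R -> R :=
  derive1 (fun r => g r / r).

Definition Vn (R : realType) (m : nat) (n : nat)
    (alpha beta : R * R -> clifford R m) (x : paravec R m) : clifford R m :=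
  cwise (iter n (@inv_r_d R)) (fun r => alpha (x.1, r)) (enorm x.2) +
  cl_dir x.2 * cwise (iter n (@d_inv_r R)) (fun r => beta (x.1, r)) (enorm x.2).

(* Main.v *)
Require Import Defs.
From mathcomp Require Import all_boot all_order all_algebra finmap.
From mathcomp Require Import all_classical all_reals all_analysis.
From mathcomp Require Import complex ring lra.
Import Order.TTheory GRing.Theory Num.Theory.
Import numFieldNormedType.Exports.
Local Open Scope classical_set_scope.
Local Open Scope ring_scope.

Set Implicit Arguments.
Unset Strict Implicit.
Unset Printing Implicit Defensive.

(** Write V_n f = A + omega B with A = (r^-1 d_r)^n alpha and B = (d_r r^-1)^n beta, and
  put b = B / r, so that V_n f = A + x b for the vector part x. The theorem is the identity
    D_k (V_n f) = (2 n + 1 - m - 2 gamma_k) b,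
  whose coefficient vanishes exactly when gamma_k = n + (1 - m) / 2; with gamma_k = 0 the
  same identity treats the Cauchy-Riemann operator. It has three ingredients.

  Propagation of the Cauchy-Riemann equations. The two operators turn the equations of
  (alpha, beta) into
    d_s A = d_r B + (2 n / r) B,    d_r A = - d_s B.
  The passage from n to n + 1 is a one-line computation ([radial_CR_succ]) once all the
  derivatives that it mentions are known to exist.

  Clifford computation. The product rule, with e_j^2 = -1 and x^2 = - r^2, gives
    (d_0 + sum_j e_j d_j) (A + x b) = (d_s A - d_r B - (m - 1) b) + omega (d_r A + d_s B),
  which the system above reduces to (2 n + 1 - m) b ([gen_CR_g]). The reflections preserve
  x_0 and r, hence A and b, so the difference part of T_j sees only the factor x. For a
  normalized root a one has x - sigma_a x = <a, x> a: the difference quotient of V_n f is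
  a b, which is continuous across the mirror. Since a^2 = -2, the roots contribute
  - 2 gamma_k b in total ([diff_quot_g], [dunkl_CR_g]).

  Regularity. The components of a holomorphic stem function are only assumed to be
  differentiable at each point, whereas V_n differentiates them n times and D_k once more.
  So one needs the theorem of Goursat: the derivative of a holomorphic function of one
  variable is holomorphic ([cdiff_derivative]). Each pair of coordinates of
  (alpha, beta) in the basis e_S is such a function. The proof is the classical one, on
  rectangles: the integral along the boundary of a rectangle vanishes ([goursat], by
  bisection), also if the function is merely continuous at one interior point
  ([goursat_punctured]); applied to a difference quotient, this yields the integral formula
  ([cauchy_formula]), and its right-hand side can be differentiated twice under the
  integral sign ([cauchy_kernel_diff]). *)

Local Notation Re := (@complex.Re _).
Local Notation Im := (@complex.Im _).
Local Notation cabs := (@Normc.normc _).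

(** * Complex modulus, limits and derivatives *)

Section Modulus.
Context {R : realType}.
Implicit Types z w : R[i].

Lemma ReD z w : Re (z + w) = Re z + Re w. Proof. by case: z w => [a b] [c d]. Qed.
Lemma ImD z w : Im (z + w) = Im z + Im w. Proof. by case: z w => [a b] [c d]. Qed.
Lemma ReN z : Re (- z) = - Re z. Proof. by case: z. Qed.
Lemma ImN z : Im (- z) = - Im z. Proof. by case: z. Qed.
Lemma ReM z w : Re (z * w) = Re z * Re w - Im z * Im w.
Proof. by case: z w => [a b] [c d]. Qed.
Lemma ImM z w : Im (z * w) = Re z * Im w + Im z * Re w.
Proof. by case: z w => [a b] [c d]. Qed.
Lemma ReV z : Re z^-1 = Re z / (Re z ^+ 2 + Im z ^+ 2).
Proof. by case: z. Qed.
Lemma ImV z : Im z^-1 = - Im z / (Re z ^+ 2 + Im z ^+ 2).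
Proof. by case: z => a b /=; rewrite mulNr. Qed.
Definition ReImE := (ReD, ImD, ReN, ImN, ReM, ImM).

Lemma complex_eqP z w : Re z = Re w -> Im z = Im w -> z = w.
Proof. by case: z w => [? ?] [? ?] /= -> ->. Qed.

Lemma cabs_ge0 z : 0 <= cabs z. Proof. by case: z => a b; apply: sqrtr_ge0. Qed.
Lemma cabs_eq0 z : (cabs z == 0) = (z == 0).
Proof.
apply/eqP/eqP => [/Normc.eq0_normc //|->]; exact: Normc.normc0.
Qed.
Lemma cabs_gt0 z : (0 < cabs z) = (z != 0).
Proof. by rewrite lt_neqAle cabs_ge0 andbT eq_sym cabs_eq0. Qed.
Lemma cabsM z w : cabs (z * w) = cabs z * cabs w. Proof. exact: Normc.normcM. Qed.
Lemma cabsV z : cabs z^-1 = (cabs z)^-1. Proof. exact: Normc.normcV. Qed.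
Lemma cabsN z : cabs (- z) = cabs z. Proof. exact: normcN. Qed.
Lemma cabsD z w : cabs (z + w) <= cabs z + cabs w. Proof. exact: le_normcD. Qed.
Lemma cabsB z w : cabs (z - w) <= cabs z + cabs w.
Proof. by rewrite -(cabsN w) cabsD. Qed.
Lemma cabs0 : cabs (0 : R[i]) = 0. Proof. exact: Normc.normc0. Qed.

Lemma Re_le_cabs z : `|Re z| <= cabs z.
Proof. by case: z => a b /=; rewrite -sqrtr_sqr ler_wsqrtr// lerDl sqr_ge0. Qed.
Lemma Im_le_cabs z : `|Im z| <= cabs z.
Proof. by case: z => a b /=; rewrite -sqrtr_sqr ler_wsqrtr// lerDr sqr_ge0. Qed.
Lemma cabs_le_ReIm z : cabs z <= `|Re z| + `|Im z|.
Proof.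
case: z => a b /=; rewrite -[leRHS]ger0_norm ?addr_ge0// -sqrtr_sqr ler_wsqrtr//.
by rewrite sqrrD !real_normK ?num_real// lerD2r lerDl mulrn_wge0 ?mulr_ge0.
Qed.

Lemma sqr_cabs z : cabs z ^+ 2 = Re z ^+ 2 + Im z ^+ 2.
Proof. by case: z => a b /=; rewrite sqr_sqrtr ?addr_ge0 ?sqr_ge0. Qed.

End Modulus.

Definition nbC {R : realType} (z : R[i]) : set_system R[i] :=
  [set P | exists2 d : R, 0 < d & forall w, cabs (w - z) < d -> P w].

Definition nbCx {R : realType} (z : R[i]) : set_system R[i] :=
  within [set w | w != z] (nbC z).

Global Instance nbC_proper {R : realType} (z : R[i]) : ProperFilter (nbC z).
Proof.
split; first by move=> [d d0 /(_ z)]; rewrite subrr cabs0; apply.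
split.
- by exists 1.
- move=> P Q [d d0 hP] [e e0 hQ]; exists (Num.min d e); first by rewrite lt_min d0.
  by move=> w; rewrite lt_min => /andP[/hP ? /hQ].
- by move=> P Q PQ [d d0 hP]; exists d => // w /hP/PQ.
Qed.

Global Instance nbCx_filter {R : realType} (z : R[i]) : Filter (nbCx z).
Proof. exact: within_filter. Qed.

(** Limits are taken coordinatewise, so that they inherit the algebra of real limits;
  [climP] gives back the form with the modulus. *)
Definition clim {R : realType} {T : Type} (F : set_system T) (f : T -> R[i])
    (l : R[i]) : Prop :=
  (Re (f x) @[x --> F] --> Re l) /\ (Im (f x) @[x --> F] --> Im l).

Definition cdiff {R : realType} (f : R[i] -> R[i]) (z l : R[i]) :=
  clim (nbCx z) (fun w => (f w - f z) / (w - z)) l.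

Section Limits.
Context {R : realType} {T : Type} (F : set_system T) {FF : Filter F}.
Implicit Types f g : T -> R[i].

Lemma clim_cst (k : R[i]) : clim F (fun=> k) k.
Proof. by split; exact: cvg_cst. Qed.

Lemma climD f g k l : clim F f k -> clim F g l -> clim F (fun x => f x + g x) (k + l).
Proof.
move=> [f1 f2] [g1 g2]; split; under eq_fun do rewrite ReImE; rewrite ReImE; exact: cvgD.
Qed.

Lemma climN f k : clim F f k -> clim F (fun x => - f x) (- k).
Proof.
move=> [f1 f2]; split; under eq_fun do rewrite ReImE; rewrite ReImE; exact: cvgN.
Qed.

Lemma climB f g k l : clim F f k -> clim F g l -> clim F (fun x => f x - g x) (k - l).
Proof. by move=> fk gl; apply: climD => //; exact: climN. Qed.

Lemma climM f g k l : clim F f k -> clim F g l -> clim F (fun x => f x * g x) (k * l).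
Proof.
move=> [f1 f2] [g1 g2]; split; under eq_fun do rewrite ReImE; rewrite ReImE.
  by apply: cvgB; exact: cvgM.
by apply: cvgD; exact: cvgM.
Qed.

Lemma climV f k : k != 0 -> clim F f k -> clim F (fun x => (f x)^-1) k^-1.
Proof.
move=> k0 [f1 f2].
have n0 : Re k ^+ 2 + Im k ^+ 2 != 0 by rewrite -sqr_cabs expf_eq0/= cabs_eq0.
have n : Re (f x) ^+ 2 + Im (f x) ^+ 2 @[x --> F] --> Re k ^+ 2 + Im k ^+ 2.
  by apply: cvgD; rewrite !expr2; apply: cvgM.
split; [under eq_fun do rewrite ReV; rewrite ReV|under eq_fun do rewrite ImV; rewrite ImV].
  by apply: cvgM => //; exact: cvgV.
by apply: cvgM; [exact: cvgN | exact: cvgV].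
Qed.

Lemma clim_near f g l : (\forall x \near F, f x = g x) -> clim F f l -> clim F g l.
Proof.
move=> fg [f1 f2]; split.
  by apply: cvg_trans f1; apply: near_eq_cvg; near=> x; rewrite (near fg x).
by apply: cvg_trans f2; apply: near_eq_cvg; near=> x; rewrite (near fg x).
Unshelve. all: by end_near. Qed.

Lemma climP f l : clim F f l <->
  forall e, 0 < e -> \forall x \near F, cabs (f x - l) < e.
Proof.
split=> [[f1 f2] e e0|H].
  have e2 : 0 < e / 2 by rewrite divr_gt0.
  move/cvgrPdist_lt : f1 => /(_ _ e2) f1; move/cvgrPdist_lt : f2 => /(_ _ e2) f2.
  near=> x.
  apply: le_lt_trans (cabs_le_ReIm _) _; rewrite !ReImE (splitr e) ltrD//.
    by rewrite distrC; near: x.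
  by rewrite distrC; near: x.
split; apply/cvgrPdist_lt => e e0; near=> x; rewrite distrC.
  rewrite -ReN -ReD; apply: le_lt_trans (Re_le_cabs _) _; near: x; exact: H.
rewrite -ImN -ImD; apply: le_lt_trans (Im_le_cabs _) _; near: x; exact: H.
Unshelve. all: by end_near. Qed.

End Limits.

Section Derivative.
Context {R : realType}.
Implicit Types (f g : R[i] -> R[i]) (z w k l : R[i]).

Lemma clim_id z : clim (nbC z) id z.
Proof. by apply/climP => e e0; exists e. Qed.

Lemma clim_nbCx f z l : clim (nbC z) f l -> clim (nbCx z) f l.
Proof. by move=> [? ?]; split; exact: cvg_within_filter. Qed.

Lemma nearCx z (P : set R[i]) : (\forall w \near nbC z, w != z -> P w) ->
  \forall w \near nbCx z, P w.
Proof. by []. Qed.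

Lemma clim_of_nbCx f z l : f z = l -> clim (nbCx z) f l -> clim (nbC z) f l.
Proof.
move=> fz /climP H; apply/climP => e e0.
have h : \forall w \near nbC z, w != z -> cabs (f w - l) < e := H e e0.
apply: filterS h => w; have [->|wz] := eqVneq w z; last by apply.
by rewrite fz subrr cabs0.
Qed.

Lemma cdiff_clim f z l : cdiff f z l -> clim (nbC z) f (f z).
Proof.
move=> df; apply: clim_of_nbCx => //.
have E : f z = f z + l * (z - z) by ring.
rewrite E; apply: (@clim_near _ _ _ _ (fun w => f z + (f w - f z) / (w - z) * (w - z))).
  apply: nearCx; near=> w => wz; by rewrite divfK ?subr_eq0 1?addrC ?subrK.
apply: climD; first exact: clim_cst.
apply: climM => //; apply: clim_nbCx; apply: climB; [exact: clim_id|exact: clim_cst].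
Unshelve. all: by end_near. Qed.

Lemma cdiff_near f g z l : (\forall w \near nbC z, f w = g w) ->
  cdiff f z l -> cdiff g z l.
Proof.
move=> fg; apply: clim_near; have fgz : f z = g z by case: fg => d d0; apply; rewrite subrr cabs0.
by apply: filterS fg => w fgw _; rewrite fgw fgz.
Qed.

Lemma cdiff_cst k z : cdiff (fun=> k) z 0.
Proof. by rewrite /cdiff; under eq_fun do rewrite subrr mul0r; exact: clim_cst. Qed.

Lemma cdiff_id z : cdiff id z 1.
Proof.
apply: (@clim_near _ _ _ _ (fun=> 1)); last exact: clim_cst.
by apply: nearCx; near=> w => wz; rewrite divff ?subr_eq0.
Unshelve. all: by end_near. Qed.

Lemma cdiffD f g z k l : cdiff f z k -> cdiff g z l ->
  cdiff (fun w => f w + g w) z (k + l).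
Proof.
move=> df dg; rewrite /cdiff.
rewrite (_ : (fun w => _) = (fun w => (f w - f z) / (w - z) + (g w - g z) / (w - z))).
  exact: climD.
by apply/funext => w; ring.
Qed.

Lemma cdiffM f g z k l : cdiff f z k -> cdiff g z l ->
  cdiff (fun w => f w * g w) z (k * g z + f z * l).
Proof.
move=> df dg; rewrite /cdiff.
rewrite (_ : (fun w => _) =
    (fun w => (f w - f z) / (w - z) * g w + f z * ((g w - g z) / (w - z)))).
  apply: climD; apply: climM => //; [exact/clim_nbCx/cdiff_clim/dg | exact: clim_cst].
by apply/funext => w; ring.
Qed.

Lemma cdiffN f z k : cdiff f z k -> cdiff (fun w => - f w) z (- k).
Proof.
move=> df; have := cdiffM (cdiff_cst (-1) z) df.
rewrite mul0r add0r mulN1r; apply: cdiff_near; near=> w; exact: mulN1r.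
Unshelve. all: by end_near. Qed.

Lemma cdiffB f g z k l : cdiff f z k -> cdiff g z l ->
  cdiff (fun w => f w - g w) z (k - l).
Proof. by move=> df dg; apply: cdiffD => //; exact: cdiffN. Qed.

Lemma cdiff_neq0 f z k : cdiff f z k -> f z != 0 -> \forall w \near nbC z, f w != 0.
Proof.
move=> /cdiff_clim/climP H fz; have h := H _ (etrans (cabs_gt0 (f z)) fz).
by apply: filterS h => w; apply: contraTneq => ->; rewrite sub0r cabsN ltxx.
Qed.

Lemma cdiffV f z k : f z != 0 -> cdiff f z k ->
  cdiff (fun w => (f w)^-1) z (- k / f z ^+ 2).
Proof.
move=> fz df; rewrite /cdiff.
apply: (@clim_near _ _ _ _ (fun w => - ((f w - f z) / (w - z)) * ((f w)^-1 * (f z)^-1))).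
  apply: nearCx; near=> w => wz.
  have ? : f w != 0 by near: w; exact: cdiff_neq0 df fz.
  by field; rewrite subr_eq0; apply/and3P.
rewrite expr2 invfM; apply: climM; first exact: climN.
apply: climM; last exact: clim_cst.
by apply: climV => //; exact/clim_nbCx/cdiff_clim/df.
Unshelve. all: by end_near. Qed.

(** The first-order expansion that both the estimates of boundary integrals and the real
  differentials work with. *)
Lemma cdiffP f z l : cdiff f z l <-> forall e, 0 < e ->
  \forall w \near nbC z, cabs (f w - f z - l * (w - z)) <= e * cabs (w - z).
Proof.
split=> [/climP H e e0|H].
  have h : \forall w \near nbC z, w != z -> cabs ((f w - f z) / (w - z) - l) < e := H e e0.
  apply: filterS h => w.
  have [-> _|wz /(_ isT) /ltW h] := eqVneq w z.
    by rewrite !subrr mulr0 subrr cabs0 mulr0.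
  rewrite -(@ler_pdivrMr _ (cabs (w - z))) ?cabs_gt0 ?subr_eq0// -cabsV -cabsM.
  by rewrite mulrBl mulfK// subr_eq0.
apply/climP => e e0; apply: nearCx.
have e2 : 0 < e / 2 by rewrite divr_gt0.
apply: filterS (H _ e2) => w h wz.
apply: (@le_lt_trans _ _ (e / 2)); last by lra.
have ? : w - z != 0 by rewrite subr_eq0.
have -> : (f w - f z) / (w - z) - l = (f w - f z - l * (w - z)) / (w - z).
  by rewrite [RHS]mulrBl mulfK.
by rewrite cabsM cabsV ler_pdivrMr ?cabs_gt0.
Qed.

End Derivative.

(** * Integrals along segments and boundaries of rectangles *)

Section SegmentIntegral.
Context {R : realType}.
Implicit Types (p q : R -> R) (g h : R -> R[i]) (a b m : R).

Local Notation mu := (@lebesgue_measure R).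

Definition rint p a b : R := \int[mu]_(x in `[a, b]) p x.

Definition cint g a b : R[i] :=
  Complex (rint (Re \o g) a b) (rint (Im \o g) a b).

Definition ctn_seg g a b := forall s, a <= s <= b -> clim (nbhs s) g (g s).

Lemma continuous_integrable p a b :
  (forall s, a <= s <= b -> p x @[x --> s] --> p s) ->
  mu.-integrable `[a, b] (EFin \o p).
Proof.
move=> cp; apply: continuous_compact_integrable; first exact: segment_compact.
apply: continuous_in_subspaceT => s; rewrite inE/= in_itv/= => sab.
exact: cp.
Qed.

Lemma rint_cst k a b : a <= b -> rint (fun=> k) a b = k * (b - a).
Proof.
move=> ab; rewrite /rint Rintegral_cst//= lebesgue_measure_itv/= lte_fin.
case: ltP => [_ //|ba]; have -> : a = b by apply/eqP; rewrite eq_le ab.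
by rewrite subrr.
Qed.

Lemma rint_split p a m b : a <= m -> m <= b ->
  (forall s, a <= s <= b -> p x @[x --> s] --> p s) ->
  rint p a b = rint p a m + rint p m b.
Proof.
move=> am mb cp.
have /(@Rintegral_itvB _ p (BLeft a) (BRight b) m) := continuous_integrable cp.
move=> /(_ am mb)/eqP; rewrite subr_eq addrC => /eqP E.
rewrite /rint E; congr (_ + _); rewrite Rintegral_itv_obnd_cbnd//.
have : mu.-integrable `[m, b] (EFin \o p).
  apply: continuous_integrable => s /andP[ms sb]; apply: cp.
  by rewrite (le_trans am).
by apply: integrableS => //; exact: subset_itv_oc_cc.
Qed.

Lemma rint_ext p q a b : (forall s, a <= s <= b -> p s = q s) -> rint p a b = rint q a b.
Proof.
by move=> pq; apply: eq_Rintegral => s; rewrite inE/= in_itv/= => /pq.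
Qed.

Section CintTheory.
Variables (a b : R).
Hypothesis ab : a <= b.
Implicit Types (k : R[i]) (M : R).

Lemma rintD p q : (forall s, a <= s <= b -> p x @[x --> s] --> p s) ->
  (forall s, a <= s <= b -> q x @[x --> s] --> q s) ->
  rint (fun s => p s + q s) a b = rint p a b + rint q a b.
Proof. by move=> cp cq; rewrite /rint RintegralD//; exact: continuous_integrable. Qed.

Lemma rintZ (r : R) p : (forall s, a <= s <= b -> p x @[x --> s] --> p s) ->
  rint (fun s => r * p s) a b = r * rint p a b.
Proof. by move=> cp; rewrite /rint RintegralZl//; exact: continuous_integrable. Qed.

Lemma rint_le p q : (forall s, a <= s <= b -> p x @[x --> s] --> p s) ->
  (forall s, a <= s <= b -> q x @[x --> s] --> q s) ->
  (forall s, a <= s <= b -> p s <= q s) -> rint p a b <= rint q a b.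
Proof.
move=> cp cq pq; apply: le_Rintegral => //; try exact: continuous_integrable.
Qed.

Lemma rint_norm p M : (forall s, a <= s <= b -> p x @[x --> s] --> p s) ->
  (forall s, a <= s <= b -> `|p s| <= M) -> `|rint p a b| <= M * (b - a).
Proof.
move=> cp pM; rewrite ler_norml -mulNr -!rint_cst//; apply/andP; split;
  apply: rint_le => // [s _|s /pM]; try exact: cvg_cst; by rewrite ler_norml => /andP[].
Qed.

Lemma cintD g h : ctn_seg g a b -> ctn_seg h a b ->
  cint (fun s => g s + h s) a b = cint g a b + cint h a b.
Proof.
move=> cg ch; apply: complex_eqP; rewrite ReImE /cint /= -rintD.
- by apply: rint_ext => s _ /=; rewrite ReImE.
- by move=> s /cg[].
- by move=> s /ch[].
- by apply: rint_ext => s _ /=; rewrite ReImE.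
- by move=> s /cg[].
- by move=> s /ch[].
Qed.

Lemma cintZ k g : ctn_seg g a b -> cint (fun s => k * g s) a b = k * cint g a b.
Proof.
move=> cg.
have c1 s : a <= s <= b -> Re (g x) @[x --> s] --> Re (g s) by move=> /cg[].
have c2 s : a <= s <= b -> Im (g x) @[x --> s] --> Im (g s) by move=> /cg[].
apply: complex_eqP; rewrite ReImE /cint /=.
  rewrite -mulNr -!rintZ// -rintD.
  - by apply: rint_ext => s _ /=; rewrite ReImE mulNr.
  - by move=> s /c1 ?; apply: cvgMr.
  - by move=> s /c2 ?; apply: cvgMr.
rewrite -!rintZ// -rintD.
- by apply: rint_ext => s _ /=; rewrite ReImE.
- by move=> s /c2 ?; apply: cvgMr.
- by move=> s /c1 ?; apply: cvgMr.
Qed.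

Lemma cint_cst k : cint (fun=> k) a b = k * (b - a)%:C%C.
Proof.
by apply: complex_eqP; rewrite ReImE /cint /= rint_cst// ?mulr0 ?subr0 ?add0r// mulr0 add0r.
Qed.

(** The factor 2 comes from bounding the real and the imaginary part separately. *)
Lemma cint_bound g M : ctn_seg g a b -> (forall s, a <= s <= b -> cabs (g s) <= M) ->
  cabs (cint g a b) <= 2 * M * (b - a).
Proof.
move=> cg gM; apply: le_trans (cabs_le_ReIm _) _; rewrite -mulrA mulr_natl mulr2n.
apply: lerD; apply: rint_norm => s sab /=.
- by case: (cg _ sab).
- exact: le_trans (Re_le_cabs _) (gM _ sab).
- by case: (cg _ sab).
- exact: le_trans (Im_le_cabs _) (gM _ sab).
Qed.

End CintTheory.

Lemma cint_split g a m b : a <= m -> m <= b -> ctn_seg g a b ->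
  cint g a b = cint g a m + cint g m b.
Proof.
move=> am mb cg; apply: complex_eqP; rewrite ReImE /cint /=.
  by apply: rint_split => // s /cg[].
by apply: rint_split => // s /cg[].
Qed.

Lemma cint_ext g h a b : (forall s, a <= s <= b -> g s = h s) -> cint g a b = cint h a b.
Proof. by move=> gh; rewrite /cint; congr Complex; apply: rint_ext => s /gh /= ->. Qed.

End SegmentIntegral.

Section Rectangle.
Context {R : realType}.
Implicit Types (f g h : R[i] -> R[i]) (a b c d : R) (z w : R[i]).

Local Notation II := (Complex 0 1 : R[i]).

(** The integral of g(z) dz along the boundary of [a, b] x [c, d], counterclockwise.
  Opposite sides are grouped under one integral sign, so that the integrands are constant
  when g is affine; see [rect_affine]. *)
Definition rect g a b c d : R[i] :=
  cint (fun s => g (Complex s c) - g (Complex s d)) a b +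
  II * cint (fun t => g (Complex b t) - g (Complex a t)) c d.

Definition in_rect a b c d z := (a <= Re z <= b) && (c <= Im z <= d).

Definition bd_rect a b c d z :=
  in_rect a b c d z && [|| Re z == a, Re z == b, Im z == c | Im z == d].

Lemma clim_comp {T U : Type} (F : set_system T) {FF : Filter F} (G : set_system U)
    (k : T -> U) (g : U -> R[i]) l :
  k x @[x --> F] --> G -> clim G g l -> clim F (g \o k) l.
Proof. by move=> kG [g1 g2]; split; [exact: cvg_comp kG g1|exact: cvg_comp kG g2]. Qed.

Lemma cvg_hline (s c : R) : Complex x c @[x --> s] --> nbC (Complex s c).
Proof.
move=> P [d d0 hP]; apply/nbhs_ballP; exists d => //= x sx; apply: hP.
apply: le_lt_trans (cabs_le_ReIm _) _; rewrite !ReImE /= subrr normr0 addr0.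
by rewrite distrC.
Qed.

Lemma cvg_vline (s c : R) : Complex s x @[x --> c] --> nbC (Complex s c).
Proof.
move=> P [d d0 hP]; apply/nbhs_ballP; exists d => //= x sx; apply: hP.
apply: le_lt_trans (cabs_le_ReIm _) _; rewrite !ReImE /= subrr normr0 add0r.
by rewrite distrC.
Qed.

Lemma clim_hline g s c : clim (nbC (Complex s c)) g (g (Complex s c)) ->
  clim (nbhs s) (fun x => g (Complex x c)) (g (Complex s c)).
Proof. exact: (clim_comp (@cvg_hline s c)). Qed.

Lemma clim_vline g s c : clim (nbC (Complex s c)) g (g (Complex s c)) ->
  clim (nbhs c) (fun x => g (Complex s x)) (g (Complex s c)).
Proof. exact: (clim_comp (@cvg_vline s c)). Qed.

Definition ctn_bd g a b c d :=
  forall z, bd_rect a b c d z -> clim (nbC z) g (g z).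

Definition ctn_rect g a b c d :=
  forall z, in_rect a b c d z -> clim (nbC z) g (g z).

Section OneRectangle.
Variables a b c d : R.
Hypotheses (ab : a <= b) (cd : c <= d).

Lemma bd_side_d s : a <= s <= b -> bd_rect a b c d (Complex s c).
Proof. by move=> sab; rewrite /bd_rect /in_rect /= sab lexx cd eqxx !orbT. Qed.
Lemma bd_side_u s : a <= s <= b -> bd_rect a b c d (Complex s d).
Proof. by move=> sab; rewrite /bd_rect /in_rect /= sab lexx cd eqxx !orbT. Qed.
Lemma bd_side_l t : c <= t <= d -> bd_rect a b c d (Complex a t).
Proof. by move=> scd; rewrite /bd_rect /in_rect /= scd lexx ab eqxx. Qed.
Lemma bd_side_r t : c <= t <= d -> bd_rect a b c d (Complex b t).
Proof. by move=> scd; rewrite /bd_rect /in_rect /= scd lexx ab eqxx !orbT. Qed.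

Lemma ctn_seg_h g : ctn_bd g a b c d ->
  ctn_seg (fun s => g (Complex s c) - g (Complex s d)) a b.
Proof.
move=> cg s sab; apply: climB; apply: clim_hline; apply: cg;
  by [exact: bd_side_d|exact: bd_side_u].
Qed.

Lemma ctn_seg_v g : ctn_bd g a b c d ->
  ctn_seg (fun t => g (Complex b t) - g (Complex a t)) c d.
Proof.
move=> cg s sab; apply: climB; apply: clim_vline; apply: cg;
  by [exact: bd_side_r|exact: bd_side_l].
Qed.

Lemma rect_ext g h : (forall z, bd_rect a b c d z -> g z = h z) ->
  rect g a b c d = rect h a b c d.
Proof.
move=> gh; rewrite /rect; congr (_ + II * _); apply: cint_ext => s sab.
  by rewrite !gh//; [exact: bd_side_u|exact: bd_side_d].
by rewrite !gh//; [exact: bd_side_l|exact: bd_side_r].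
Qed.

Lemma rectD g h : ctn_bd g a b c d -> ctn_bd h a b c d ->
  rect (fun z => g z + h z) a b c d = rect g a b c d + rect h a b c d.
Proof.
move=> cg ch; rewrite /rect addrACA -mulrDr -!cintD//;
  try exact: ctn_seg_v; try exact: ctn_seg_h.
by congr (_ + II * _); apply: cint_ext => s _; ring.
Qed.

Lemma rectZ k g : ctn_bd g a b c d ->
  rect (fun z => k * g z) a b c d = k * rect g a b c d.
Proof.
move=> cg; rewrite /rect mulrDr mulrCA -(@cintZ _ c d k)//; last exact: ctn_seg_v.
rewrite -(@cintZ _ a b k)//; last exact: ctn_seg_h.
by congr (_ + II * _); apply: cint_ext => s _; ring.
Qed.

Lemma rect_bound g (M : R) : ctn_bd g a b c d ->
  (forall z, bd_rect a b c d z -> cabs (g z) <= M) ->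
  cabs (rect g a b c d) <= 4 * M * ((b - a) + (d - c)).
Proof.
move=> cg gM; apply: le_trans (cabsD _ _) _.
rewrite cabsM (_ : cabs II = 1) ?mul1r; last first.
  by rewrite /= expr0n expr1n add0r sqrtr1.
rewrite mulrDr (_ : 4 * M = 2 * (M + M)); last by ring.
apply: lerD; apply: cint_bound => //; try exact: ctn_seg_v; try exact: ctn_seg_h.
  move=> s sab; apply: le_trans (cabsB _ _) _; apply: lerD; apply: gM.
    exact: bd_side_d.
  exact: bd_side_u.
move=> s sab; apply: le_trans (cabsB _ _) _; apply: lerD; apply: gM.
  exact: bd_side_r.
exact: bd_side_l.
Qed.

Lemma rect_affine (k l w : R[i]) : rect (fun z => k + l * (z - w)) a b c d = 0.
Proof.
rewrite /rect.
under cint_ext => s _.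
  rewrite (_ : _ - _ = l * (II * (c - d)%:C%C)); last first.
    by rewrite [Complex s c]complexE [Complex s d]complexE /= rmorphB /=; ring.
  over.
under [X in _ + II * X]cint_ext => s _.
  rewrite (_ : _ - _ = l * ((b - a)%:C%C)); last first.
    by rewrite [Complex b s]complexE [Complex a s]complexE /= rmorphB /=; ring.
  over.
by rewrite !cint_cst// !rmorphB /=; ring.
Qed.

End OneRectangle.

Lemma bd_in a b c d z : bd_rect a b c d z -> in_rect a b c d z.
Proof. by case/andP. Qed.

Lemma ctn_rect_bd g a b c d : ctn_rect g a b c d -> ctn_bd g a b c d.
Proof. by move=> H z /bd_in/H. Qed.

Lemma rect_split_h g a m b c d : a <= m -> m <= b -> c <= d ->
  ctn_rect g a b c d -> rect g a b c d = rect g a m c d + rect g m b c d.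
Proof.
move=> am mb cd cg; have ab := le_trans am mb.
rewrite /rect (@cint_split _ _ a m b)//; last exact/ctn_seg_h/ctn_rect_bd/cg.
rewrite [RHS]addrACA -mulrDr; congr (_ + II * _).
rewrite -cintD//.
- by apply: cint_ext => s _; ring.
- apply: ctn_seg_v => // z /bd_in zi; apply: cg; move: zi; rewrite /in_rect.
  by move=> /andP[/andP[? ?] ->]; rewrite andbT; apply/andP; split => //; lra.
- apply: ctn_seg_v => // z /bd_in zi; apply: cg; move: zi; rewrite /in_rect.
  by move=> /andP[/andP[? ?] ->]; rewrite andbT; apply/andP; split => //; lra.
Qed.

Lemma rect_split_v g a b c m d : a <= b -> c <= m -> m <= d ->
  ctn_rect g a b c d -> rect g a b c d = rect g a b c m + rect g a b m d.
Proof.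
move=> ab cm md cg; have cd := le_trans cm md.
rewrite /rect [X in II * X](@cint_split _ _ c m d)//; last exact/ctn_seg_v/ctn_rect_bd/cg.
rewrite [RHS]addrACA -mulrDr; congr (_ + II * _).
rewrite -cintD//.
- by apply: cint_ext => s _; ring.
- apply: ctn_seg_h => // z /bd_in zi; apply: cg; move: zi; rewrite /in_rect.
  by move=> /andP[-> /andP[? ?]] /=; apply/andP; split => //; lra.
- apply: ctn_seg_h => // z /bd_in zi; apply: cg; move: zi; rewrite /in_rect.
  by move=> /andP[-> /andP[? ?]] /=; apply/andP; split => //; lra.
Qed.

End Rectangle.

(** * The theorem of Goursat *)

Section Goursat.
Context {R : realType}.
Implicit Types (f g h : R[i] -> R[i]) (a b c d : R) (z w : R[i]).

Lemma nested_intervals (u v : nat -> R) :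
  (forall n, u n <= u n.+1) -> (forall n, v n.+1 <= v n) -> (forall n, u n <= v n) ->
  exists x, forall n, u n <= x <= v n.
Proof.
move=> /nondecreasing_seqP ndu /nonincreasing_seqP niv uv.
have uvnm n k : u n <= v k.
  apply: le_trans (ndu _ _ (leq_maxl n k)) _.
  exact: le_trans (uv _) (niv _ _ (leq_maxr n k)).
have ubv k : ubound (range u) (v k) by move=> _ [n _ <-].
exists (sup (range u)) => n; apply/andP; split.
  by apply: ub_le_sup; [exists (v 0%N)|exists n].
by apply: ge_sup => //; exists (u 0%N), 0%N.
Qed.

(** If P failed, it would fail on a quarter, on a quarter of that quarter, and so on; the
  nested rectangles shrink to a point z. The local hypothesis concerns the rectangles that
  contain z, and all the nested ones do. *)
Lemma bisection (P : R -> R -> R -> R -> Prop) a0 b0 c0 d0 :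
  a0 <= b0 -> c0 <= d0 ->
  (forall a b c d, a0 <= a -> a <= b -> b <= b0 -> c0 <= c -> c <= d -> d <= d0 ->
    let m := (a + b) / 2 in let n := (c + d) / 2 in
    P a m c n -> P m b c n -> P a m n d -> P m b n d -> P a b c d) ->
  (forall z, in_rect a0 b0 c0 d0 z -> exists2 e, 0 < e &
    forall a b c d, a0 <= a -> a <= b -> b <= b0 -> c0 <= c -> c <= d -> d <= d0 ->
    in_rect a b c d z -> b - a < e -> d - c < e -> P a b c d) ->
  P a0 b0 c0 d0.
Proof.
move=> ab0 cd0 step loc; apply: contrapT => nP0.
(* One choice function for the next quarter, trivial on the quadruples where P holds. *)
pose good (Q : R * R * R * R) := let: (a, b, c, d) := Q in
  [/\ a0 <= a, a <= b & b <= b0] /\ [/\ c0 <= c, c <= d & d <= d0] /\ ~ P a b c d.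
pose quarter (Q Q' : R * R * R * R) :=
  let: (a, b, c, d) := Q in let: (a', b', c', d') := Q' in
  [/\ a <= a', b' <= b & b' - a' = (b - a) / 2] /\
  [/\ c <= c', d' <= d & d' - c' = (d - c) / 2].
have /choice[nxt nxtP] : forall Q, exists Q', good Q -> good Q' /\ quarter Q Q'.
  move=> [[[a b] c] d].
  have [[[a0a ab bb0] [[c0c cd dd0] nP]]|ngood] := pselect (good (a, b, c, d)); last first.
    by exists (a, b, c, d).
  pose m := (a + b) / 2; pose n := (c + d) / 2.
  have st := step a b c d a0a ab bb0 c0c cd dd0.
  have {st}: ~ (P a m c n /\ P m b c n /\ P a m n d /\ P m b n d).
    by move=> [? [? [? ?]]]; apply: nP; exact: st.
  rewrite /good /quarter => /not_andP[h|/not_andP[h|/not_andP[h|h]]].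
  - exists (a, m, c, n) => _; rewrite /m /n in h *; do !split => //; lra.
  - exists (m, b, c, n) => _; rewrite /m /n in h *; do !split => //; lra.
  - exists (a, m, n, d) => _; rewrite /m /n in h *; do !split => //; lra.
  - exists (m, b, n, d) => _; rewrite /m /n in h *; do !split => //; lra.
pose Q k := iter k nxt (a0, b0, c0, d0).
have gQ k : good (Q k) by elim: k => [//|k /nxtP[]].
have qQ k : quarter (Q k) (Q k.+1) by have [] := nxtP _ (gQ k).
pose qa k := (Q k).1.1.1; pose qb k := (Q k).1.1.2; pose qc k := (Q k).1.2; pose qd k := (Q k).2.
have QE k : Q k = (qa k, qb k, qc k, qd k).
  by rewrite /qa /qb /qc /qd; case: (Q k) => [[[]]].
have {}gQ k : [/\ a0 <= qa k, qa k <= qb k & qb k <= b0] /\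
    [/\ c0 <= qc k, qc k <= qd k & qd k <= d0] /\ ~ P (qa k) (qb k) (qc k) (qd k).
  by have := gQ k; rewrite QE.
have {}qQ k : [/\ qa k <= qa k.+1, qb k.+1 <= qb k & qb k.+1 - qa k.+1 = (qb k - qa k) / 2] /\
    [/\ qc k <= qc k.+1, qd k.+1 <= qd k & qd k.+1 - qc k.+1 = (qd k - qc k) / 2].
  by have := qQ k; rewrite (QE k) (QE k.+1).
have [x xP] : exists x, forall n, qa n <= x <= qb n.
  by apply: nested_intervals => k; [have [[]] := qQ k|have [[]] := qQ k|have [[]] := gQ k].
have [y yP] : exists y, forall n, qc n <= y <= qd n.
  by apply: nested_intervals => k; [have [_ []] := qQ k|have [_ []] := qQ k|have [_ [[]]] := gQ k].
have [|e e0 eP] := loc (Complex x y).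
  by rewrite /in_rect /=; apply/andP; exact: conj (xP 0%N) (yP 0%N).
have wQ k : qb k - qa k = (b0 - a0) / 2 ^+ k.
  elim: k => [|k IH]; first by rewrite expr0 divr1.
  by have [[_ _ ->] _] := qQ k; rewrite IH exprSr invfM mulrA.
have hQ k : qd k - qc k = (d0 - c0) / 2 ^+ k.
  elim: k => [|k IH]; first by rewrite expr0 divr1.
  by have [_ [_ _ ->]] := qQ k; rewrite IH exprSr invfM mulrA.
have [k kP] : exists k, (b0 - a0 + (d0 - c0)) / 2 ^+ k < e.
  have /cvgrPdist_lt/(_ _ e0)[k _ /(_ k (leqnn k))] :
      (b0 - a0 + (d0 - c0)) / 2 ^+ n @[n --> \oo] --> (0 : R).
    rewrite -(mulr0 (b0 - a0 + (d0 - c0))); apply: cvgMr.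
    by under eq_fun do rewrite -exprVn; apply: cvg_expr; rewrite ger0_norm; lra.
  by rewrite sub0r normrN => /ltr_normlW h; exists k.
have [[? ? ?] [[? ? ?]]] := gQ k; apply.
have ? : 0 <= (b0 - a0) / 2 ^+ k by rewrite divr_ge0 ?subr_ge0 ?exprn_ge0.
have ? : 0 <= (d0 - c0) / 2 ^+ k by rewrite divr_ge0 ?subr_ge0 ?exprn_ge0.
rewrite mulrDl in kP.
apply: eP => //; first by rewrite /in_rect /= xP yP.
  by rewrite wQ; lra.
by rewrite hQ; lra.
Qed.

(** Close to z the function is affine up to e |w - z|, and the affine part integrates to 0, so
  the integral along the boundary of a small W x H rectangle is at most e (W^2 + H^2). This
  bound adds up over the four quarters of a rectangle, hence holds for the whole one,
  for every e. *)
Lemma goursat g a b c d : a <= b -> c <= d ->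
  (forall z, in_rect a b c d z -> exists l, cdiff g z l) -> rect g a b c d = 0.
Proof.
move=> ab cd dg.
have cg : ctn_rect g a b c d by move=> z /dg[l]; exact: cdiff_clim.
have sub a' b' c' d' : a <= a' -> b' <= b -> c <= c' -> d' <= d -> ctn_rect g a' b' c' d'.
  move=> ? ? ? ? z /andP[/andP[? ?] /andP[? ?]]; apply: cg.
  by rewrite /in_rect; apply/andP; split; apply/andP; split; lra.
suff H e : 0 < e -> cabs (rect g a b c d) <= e * ((b - a) ^+ 2 + (d - c) ^+ 2).
  apply/eqP; rewrite -cabs_eq0; apply/negPn/negP => n0.
  have r0 : 0 < cabs (rect g a b c d) by rewrite lt_neqAle eq_sym n0 cabs_ge0.
  set S := (b - a) ^+ 2 + (d - c) ^+ 2 in H.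
  have S0 : 0 <= S by rewrite addr_ge0 ?sqr_ge0.
  have := H (cabs (rect g a b c d) / (2 * (S + 1))).
  rewrite divr_gt0//; last by lra.
  move=> /(_ isT); rewrite -mulrA -[leLHS]mulr1 ler_pM2l//.
  rewrite mulrC ler_pdivlMr; lra.
move=> e0; pose P a b c d := cabs (rect g a b c d) <= e * ((b - a) ^+ 2 + (d - c) ^+ 2).
apply: (@bisection P) => //.
  move=> a' b' c' d' ? ? ? ? ? ? m n; rewrite /P => p1 p2 p3 p4.
  have am : a' <= m by rewrite /m; lra.
  have mb : m <= b' by rewrite /m; lra.
  have cn : c' <= n by rewrite /n; lra.
  have nd : n <= d' by rewrite /n; lra.
  have -> : rect g a' b' c' d' = rect g a' m c' d' + rect g m b' c' d'.
    by apply: rect_split_h => //; exact: sub.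
  have -> : rect g a' m c' d' = rect g a' m c' n + rect g a' m n d'.
    by apply: rect_split_v => //; apply: sub => //; exact: le_trans mb _.
  have -> : rect g m b' c' d' = rect g m b' c' n + rect g m b' n d'.
    by apply: rect_split_v => //; apply: sub => //; exact: le_trans am.
  apply: le_trans (cabsD _ _) _.
  apply: le_trans (lerD (cabsD _ _) (cabsD _ _)) _.
  apply: le_trans (lerD (lerD p1 p3) (lerD p2 p4)) _.
  by rewrite /m /n le_eqVlt; apply/orP; left; apply/eqP; field.
move=> z zin; have [l /cdiffP dgz] := dg _ zin.
(* 4 (e / 8) (W + H)^2 <= e (W^2 + H^2), the 4 being that of [rect_bound]. *)
have e8 : 0 < e / 8 by rewrite divr_gt0.
have [dl dl0 dlP] := dgz _ e8.
exists (dl / 2); first by rewrite divr_gt0.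
move=> a' b' c' d' aa' ab' bb' cc' cd' dd' zin' W H; rewrite /P.
have cg' : ctn_bd g a' b' c' d' by apply: ctn_rect_bd; exact: sub.
have caff : ctn_bd (fun w => g z + l * (w - z)) a' b' c' d'.
  move=> w _; apply: climD; first exact: clim_cst.
  apply: climM; first exact: clim_cst.
  by apply: climB; [exact: clim_id|exact: clim_cst].
have caffN : ctn_bd (fun w => -1 * (g z + l * (w - z))) a' b' c' d'.
  by move=> w /caff ?; apply: climM => //; exact: clim_cst.
have -> : rect g a' b' c' d' =
    rect (fun w => g w + -1 * (g z + l * (w - z))) a' b' c' d'.
  by rewrite rectD// rectZ// rect_affine// mulr0 addr0.
have S : (b' - a') + (d' - c') >= 0 by lra.
apply: (@le_trans _ _ (4 * (e / 8 * ((b' - a') + (d' - c'))) * ((b' - a') + (d' - c')))).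
  apply: rect_bound => //.
    by move=> w wb; apply: climD; [exact: cg'|exact: caffN].
  move=> w /bd_in; move: zin'; rewrite /in_rect => /andP[/andP[? ?] /andP[? ?]].
  move=> /andP[/andP[? ?] /andP[? ?]].
  have wz : cabs (w - z) <= (b' - a') + (d' - c').
    apply: le_trans (cabs_le_ReIm _) _; rewrite !ReImE; apply: lerD.
      by rewrite ler_norml; apply/andP; split; lra.
    by rewrite ler_norml; apply/andP; split; lra.
  rewrite mulN1r opprD addrA; apply: le_trans (dlP _ _) _; first by lra.
  by rewrite ler_pM2l.
have := sqr_ge0 ((b' - a') - (d' - c')); move: e0; clear; nra.
Qed.

End Goursat.

(** * The integral formula of Cauchy *)

Section Cauchy.
Context {R : realType}.
Implicit Types (f g h : R[i] -> R[i]) (a b c d : R) (z w v : R[i]).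

Local Notation II := (Complex 0 1 : R[i]).

(** Four cuts isolate w in a square of half-side e. The other pieces avoid w, so they
  contribute 0, and the boundary of the square contributes O(e) since g is bounded
  near w. *)
Lemma goursat_punctured g a b c d w : a < Re w < b -> c < Im w < d ->
  ctn_rect g a b c d ->
  (forall z, in_rect a b c d z -> z != w -> exists l, cdiff g z l) ->
  rect g a b c d = 0.
Proof.
move=> /andP[aw wb] /andP[cw wd] cg dg.
set p := Re w in aw wb; set q := Im w in cw wd.
have sub a' b' c' d' : a <= a' -> b' <= b -> c <= c' -> d' <= d -> ctn_rect g a' b' c' d'.
  move=> ? ? ? ? z /andP[/andP[? ?] /andP[? ?]]; apply: cg.
  by rewrite /in_rect; apply/andP; split; apply/andP; split; lra.
have van a' b' c' d' : a <= a' -> a' <= b' -> b' <= b -> c <= c' -> c' <= d' -> d' <= d ->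
    ~~ in_rect a' b' c' d' w -> rect g a' b' c' d' = 0.
  move=> ? ? ? ? ? ? wn; apply: goursat => // z zin; apply: dg; last first.
    by apply: contraNneq wn => <-.
  move: zin => /andP[/andP[? ?] /andP[? ?]].
  by rewrite /in_rect; apply/andP; split; apply/andP; split; lra.
have wabcd : in_rect a b c d w by rewrite /in_rect; apply/andP; split; apply/andP; split; lra.
have /climP/(_ _ ltr01)[dl dl0 dlP] := cg _ wabcd.
pose M := cabs (g w) + 1.
have M0 : 0 < M by rewrite ltr_wpDl// cabs_ge0.
have main e : 0 < e -> e <= p - a -> e <= b - p -> e <= q - c -> e <= d - q -> e < dl / 2 ->
    cabs (rect g a b c d) <= 16 * M * e.
  move=> e0 ea eb ec ed edl.
  rewrite (@rect_split_h _ _ a (p - e))//; try lra.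
  rewrite van//; try lra; last first.
    by apply/negP; rewrite /in_rect -/p -/q => /andP[/andP[? ?] /andP[? ?]]; lra.
  rewrite add0r (@rect_split_h _ _ (p - e) (p + e))//; try lra; last by apply: sub; lra.
  rewrite [X in _ + X]van//; try lra; last first.
    by apply/negP; rewrite /in_rect -/p -/q => /andP[/andP[? ?] /andP[? ?]]; lra.
  rewrite addr0 (@rect_split_v _ _ _ _ c (q - e))//; try lra; last by apply: sub; lra.
  rewrite van//; try lra; last first.
    by apply/negP; rewrite /in_rect -/p -/q => /andP[/andP[? ?] /andP[? ?]]; lra.
  rewrite add0r (@rect_split_v _ _ _ _ (q - e) (q + e))//; try lra; last by apply: sub; lra.
  rewrite [X in _ + X]van//; try lra; last first.
    by apply/negP; rewrite /in_rect -/p -/q => /andP[/andP[? ?] /andP[? ?]]; lra.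
  rewrite addr0; apply: le_trans (@rect_bound _ _ _ _ _ _ _ _ M _ _) _; try lra.
    by apply: ctn_rect_bd; apply: sub; lra.
  move=> z /bd_in; rewrite /in_rect => /andP[/andP[? ?] /andP[? ?]].
  have zw : cabs (z - w) < dl.
    apply: le_lt_trans (cabs_le_ReIm _) _; rewrite !ReImE -/p -/q.
    have : `|Re z - p| <= e by rewrite ler_norml; apply/andP; split; lra.
    have : `|Im z - q| <= e by rewrite ler_norml; apply/andP; split; lra.
    lra.
  have := dlP _ zw; have := cabsD (g z - g w) (g w); rewrite subrK /M; lra.
apply/eqP; rewrite -cabs_eq0; apply/negPn/negP => n0.
have r0 : 0 < cabs (rect g a b c d) by rewrite lt_neqAle eq_sym n0 cabs_ge0.
set S := cabs (rect g a b c d) in main r0.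
(* The last term makes 16 M e at most half of the supposedly nonzero S. *)
pose e := Num.min (Num.min (Num.min (p - a) (b - p)) (Num.min (q - c) (d - q)))
  (Num.min (dl / 4) (S / (32 * M))).
have h1 : S / (32 * M) > 0 by rewrite divr_gt0// mulr_gt0.
have e0 : 0 < e.
  rewrite /e !lt_min; apply/andP; split; last by apply/andP; split; lra.
  by apply/andP; split; apply/andP; split; lra.
have : e <= e by []. rewrite {2}/e !le_min.
move=> /andP[/andP[/andP[? ?] /andP[? ?]] /andP[? eS]].
have : S <= 16 * M * e by apply: main => //; lra.
move: eS; rewrite ler_pdivlMr ?mulr_gt0// => eS.
have -> : 16 * M * e = e * (32 * M) / 2 by field.
lra.
Qed.

(** The difference quotient (f z - f w) / (z - w), with value f'(w) at w, is continuous, so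
  its boundary integral is 0. The factor that multiplies f w is 2 pi i; it is enough to know
  that it does not vanish. *)
Lemma cauchy_formula f a b c d w : a < Re w < b -> c < Im w < d ->
  (forall z, in_rect a b c d z -> exists l, cdiff f z l) ->
  f w * rect (fun z => (z - w)^-1) a b c d = rect (fun z => f z / (z - w)) a b c d.
Proof.
move=> wab wcd df.
have [aw wb] := andP wab; have [cw wd] := andP wcd.
have ab : a <= b by lra.
have cd : c <= d by lra.
have win : in_rect a b c d w by rewrite /in_rect; apply/andP; split; apply/andP; split; lra.
have [l dfw] := df _ win.
pose q z := if z == w then l else (f z - f w) / (z - w).
have bdw z : bd_rect a b c d z -> z != w.
  move=> /andP[_ zb]; apply: contraTneq zb => ->; rewrite !negb_or.
  by apply/and4P; split; apply/negP => /eqP; lra.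
have nearne z : z != w -> \forall v \near nbC z, v - w != 0.
  move=> zw; apply: (@cdiff_neq0 _ (fun v => v - w) z (1 - 0)); last by rewrite subr_eq0.
  by apply: cdiffB; [exact: cdiff_id|exact: cdiff_cst].
have dinv z : z != w -> exists k, cdiff (fun v => (v - w)^-1) z k.
  move=> zw; exists (- (1 - 0) / (z - w) ^+ 2); apply: cdiffV; first by rewrite subr_eq0.
  by apply: cdiffB; [exact: cdiff_id|exact: cdiff_cst].
have dq z : in_rect a b c d z -> z != w -> exists k, cdiff q z k.
  move=> /df[k dfz] zw; have [k' dk'] := dinv z zw.
  have dk := cdiffM (cdiffB dfz (cdiff_cst (f w) z)) dk'.
  eexists; apply: cdiff_near dk; apply: filterS (nearne _ zw) => v.
  by rewrite subr_eq0 /q => /negbTE ->.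
have cq : ctn_rect q a b c d.
  move=> z zin; have [->|zw] := eqVneq z w; last by have [k] := dq _ zin zw; exact: cdiff_clim.
  apply: clim_of_nbCx => //; rewrite {2}/q eqxx.
  by apply: clim_near dfw; exists 1 => // v _ /negbTE vw; rewrite /q vw.
have q0 : rect q a b c d = 0 by apply: goursat_punctured wab wcd cq dq.
have cinv : ctn_bd (fun z => (z - w)^-1) a b c d.
  by move=> z /bdw/dinv[k]; exact: cdiff_clim.
have -> : rect (fun z => f z / (z - w)) a b c d =
    rect (fun z => q z + f w * (z - w)^-1) a b c d.
  by apply: rect_ext => // z /bdw zw; rewrite /q (negbTE zw); ring.
rewrite rectD//; first by rewrite q0 add0r rectZ.
  exact: ctn_rect_bd.
by move=> z /cinv ?; apply: climM => //; exact: clim_cst.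
Qed.

(** The imaginary part is the sum of the angles under which the four sides are seen
  from w, and these are positive; a lower bound for the right-hand side suffices. *)
Lemma rect_inv_neq0 a b c d w : a < Re w < b -> c < Im w < d ->
  rect (fun z => (z - w)^-1) a b c d != 0.
Proof.
move=> wab wcd; have [aw wb] := andP wab; have [cw wd] := andP wcd.
have ab : a <= b by lra.
have cd : c <= d by lra.
have cinv : ctn_bd (fun z => (z - w)^-1) a b c d.
  move=> z /andP[_ zb]; have zw : z != w.
    by apply: contraTneq zb => ->; rewrite !negb_or; apply/and4P; split; apply/negP => /eqP; lra.
  apply: climV; first by rewrite subr_eq0.
  by apply: climB; [exact: clim_id|exact: clim_cst].
suff : 0 < Im (rect (fun z => (z - w)^-1) a b c d).
  by apply: contraTneq => ->; rewrite ltxx.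
rewrite /rect !ReImE /= mul0r add0r mul1r.
have [h v] := (ctn_seg_h cd cinv, ctn_seg_v ab cinv).
pose mu := (b - Re w) / ((b - Re w) ^+ 2 + (d - c) ^+ 2).
have mu0 : 0 < mu.
  by apply: divr_gt0; [lra|rewrite ltr_wpDr ?sqr_ge0 ?exprn_gt0//; lra].
apply: ltr_wpDl.
  rewrite -(mul0r (b - a)) -rint_cst//; apply: rint_le => //.
  - by move=> s _; exact: cvg_cst.
  - by move=> s /h[].
  move=> s sab; rewrite /= !ReImE !ImV !ReImE /= subr_ge0.
  apply: (@le_trans _ _ 0).
    by rewrite mulNr oppr_le0; apply: divr_ge0; [lra|rewrite addr_ge0 ?sqr_ge0].
  by apply: divr_ge0; [lra|rewrite addr_ge0 ?sqr_ge0].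
apply: (@lt_le_trans _ _ (mu * (d - c))); first by rewrite mulr_gt0//; lra.
rewrite -rint_cst//; apply: rint_le => //.
- by move=> s _; exact: cvg_cst.
- by move=> s /v[].
move=> t /andP[ct td]; rewrite /= !ReImE !ReV !ReImE /=.
apply: (@le_trans _ _ ((b - Re w) / ((b - Re w) ^+ 2 + (t - Im w) ^+ 2))).
  rewrite /mu ler_pM2l ?subr_gt0// lef_pV2 ?posrE; last 2 first.
  - by rewrite ltr_wpDr ?sqr_ge0 ?exprn_gt0//; lra.
  - by rewrite ltr_wpDr ?sqr_ge0 ?exprn_gt0//; lra.
  rewrite lerD2l -[leLHS]real_normK ?num_real// ler_sqr ?nnegrE//; last by lra.
  by rewrite ler_norml; apply/andP; split; lra.
rewrite lerDl -mulNr; apply: divr_ge0; [lra|by rewrite addr_ge0 ?sqr_ge0].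
Qed.

(** Differentiation under the integral sign, for an integrand whose Taylor remainder of
  order one is quadratic uniformly along the boundary. *)
Lemma rect_param (K K' : R[i] -> R[i] -> R[i]) a b c d w (r B : R) :
  a <= b -> c <= d -> 0 < r -> 0 <= B ->
  (forall v, cabs (v - w) < r -> ctn_bd (K^~ v) a b c d) ->
  ctn_bd (K'^~ w) a b c d ->
  (forall z v, bd_rect a b c d z -> cabs (v - w) < r ->
    cabs (K z v - K z w - K' z w * (v - w)) <= B * cabs (v - w) ^+ 2) ->
  cdiff (fun v => rect (K^~ v) a b c d) w (rect (K'^~ w) a b c d).
Proof.
move=> ab cd r0 B0 cK cK' KB; apply/cdiffP => e e0.
pose S := (b - a) + (d - c); have S0 : 0 <= S by rewrite /S; lra.
have cKw : ctn_bd (K^~ w) a b c d by apply: cK; rewrite subrr cabs0.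
exists (Num.min r (e / (4 * B * S + 1))).
  by rewrite lt_min r0 divr_gt0// ltr_wpDl// !mulr_ge0.
move=> v; rewrite lt_min => /andP[vr ve].
have cKv := cK _ vr.
have -> : rect (K^~ v) a b c d - rect (K^~ w) a b c d - rect (K'^~ w) a b c d * (v - w) =
   rect (fun z => K z v + -1 * K z w + (- (v - w)) * K' z w) a b c d.
  rewrite rectD//.
  - rewrite rectD//.
    + by rewrite !rectZ//; ring.
    + by move=> z /cKw ?; apply: climM => //; exact: clim_cst.
  - move=> z zb; apply: climD; first exact: cKv.
    by apply: climM; [exact: clim_cst|exact: cKw].
  - by move=> z /cK' ?; apply: climM => //; exact: clim_cst.
apply: le_trans (@rect_bound _ _ _ _ _ _ _ _ (B * cabs (v - w) ^+ 2) _ _) _ => //.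
- move=> z zb; apply: climD; first apply: climD; first exact: cKv.
    by apply: climM; [exact: clim_cst|exact: cKw].
  by apply: climM; [exact: clim_cst|exact: cK'].
- move=> z zb; apply: le_trans (KB z v zb vr); rewrite le_eqVlt; apply/orP; left.
  by apply/eqP; congr (cabs _); ring.
rewrite -/S expr2 (_ : 4 * _ * S = (4 * B * S) * cabs (v - w) * cabs (v - w)); last by ring.
apply: ler_wpM2r; first exact: cabs_ge0.
move/ltW: ve; rewrite ler_pdivlMr; last by rewrite ltr_wpDl// !mulr_ge0.
have := cabs_ge0 (v - w); rewrite mulrDr mulr1; lra.
Qed.

End Cauchy.

Section Regularity.
Context {R : realType}.
Implicit Types (f g h : R[i] -> R[i]) (a b c d : R) (z w v : R[i]).

Lemma cabs_inv_le z (s : R) : 0 < s -> s <= cabs z -> cabs z^-1 <= s^-1.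
Proof. by move=> s0 sz; rewrite cabsV lef_pV2 ?posrE//; exact: lt_le_trans sz. Qed.

(** Two derivatives of the Cauchy integral, one for f' and one more to differentiate f'.
  With i = 1 / (z - w), j = 1 / (z - v) and h = v - w the remainders are
  f j i^2 h^2 and f j^2 i^2 (3 - 2 h i) h^2; here |i| <= 1 / r, |j| <= 2 / r and
  |h i| <= 1 / 2. *)
Lemma cauchy_kernel_diff f a b c d w (r M : R) :
  a <= b -> c <= d -> 0 < r -> ctn_bd f a b c d ->
  (forall z, bd_rect a b c d z -> cabs (f z) <= M) ->
  (forall z, bd_rect a b c d z -> r <= cabs (z - w)) ->
  cdiff (fun v => rect (fun z => f z / (z - v)) a b c d) w
    (rect (fun z => f z / (z - w) ^+ 2) a b c d) /\
  cdiff (fun v => rect (fun z => f z / (z - v) ^+ 2) a b c d) w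
    (rect (fun z => f z * 2 / (z - w) ^+ 3) a b c d).
Proof.
move=> ab cd r0 cf fM rw.
have r2 : 0 < r / 2 by rewrite divr_gt0.
have far v z : bd_rect a b c d z -> cabs (v - w) < r / 2 -> r / 2 <= cabs (z - v).
  move=> /rw rz vw; have := cabsD (z - v) (v - w); rewrite subrKA; lra.
have ne v z : bd_rect a b c d z -> cabs (v - w) < r / 2 -> z - v != 0.
  by move=> zb vw; rewrite -cabs_gt0; apply: lt_le_trans r2 (far _ _ zb vw).
have cinv v n : cabs (v - w) < r / 2 -> ctn_bd (fun z => ((z - v) ^+ n)^-1) a b c d.
  move=> vw z zb; apply: climV; first by rewrite expf_neq0// ne.
  elim: n => [|n IH]; first by under eq_fun do rewrite expr0; exact: clim_cst.
  under eq_fun do rewrite exprS; rewrite exprS; apply: climM => //.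
  by apply: climB; [exact: clim_id|exact: clim_cst].
have ww : cabs (w - w) < r / 2 by rewrite subrr cabs0.
have M0 z : bd_rect a b c d z -> 0 <= M by move=> /fM; exact: le_trans (cabs_ge0 _).
have Mg : 0 <= M by apply: (M0 (Complex a c)); apply: bd_side_d => //; rewrite lexx ab.
have s0 : 0 < r^-1 by rewrite invr_gt0.
split.
- apply: (@rect_param _ (fun z v => f z / (z - v)) (fun z v => f z / (z - v) ^+ 2)
    _ _ _ _ _ (r / 2) (M * 2 * r^-1 ^+ 3)) => //.
  + by rewrite mulr_ge0 ?exprn_ge0 ?mulr_ge0 ?(ltW s0).
  + move=> v vw z zb; apply: climM; first exact: cf.
    by have := @cinv v 1%N vw z zb; rewrite expr1; under eq_fun do rewrite expr1.
  + by move=> z zb; apply: climM; [exact: cf|exact: cinv].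
  move=> z v zb vw; have nw := ne _ _ zb ww; have nv := ne _ _ zb vw.
  have -> : f z / (z - v) - f z / (z - w) - f z / (z - w) ^+ 2 * (v - w) =
    f z * ((z - v)^-1 * ((z - w)^-1 * (z - w)^-1)) * ((v - w) * (v - w)).
    by field; rewrite nw nv.
  rewrite 5!cabsM expr2 ler_wpM2r ?mulr_ge0 ?cabs_ge0//.
  have i1 := cabs_inv_le r0 (rw _ zb).
  have := cabs_inv_le r2 (far _ _ zb vw); rewrite invfM invrK mulrC => j1.
  rewrite (_ : M * 2 * _ = M * ((2 * r^-1) * (r^-1 * r^-1))); last by ring.
  by do 2 (apply: ler_pM; rewrite ?mulr_ge0 ?cabs_ge0 ?fM//); apply: ler_pM; rewrite ?cabs_ge0.
- apply: (@rect_param _ (fun z v => f z / (z - v) ^+ 2) (fun z v => f z * 2 / (z - v) ^+ 3)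
    _ _ _ _ _ (r / 2) (M * 16 * r^-1 ^+ 4)) => //.
  + by rewrite mulr_ge0 ?exprn_ge0 ?mulr_ge0 ?(ltW s0).
  + by move=> v vw z zb; apply: climM; [exact: cf|exact: cinv].
  + move=> z zb; apply: climM; last exact: cinv.
    by apply: climM; [exact: cf|exact: clim_cst].
  move=> z v zb vw; have nw := ne _ _ zb ww; have nv := ne _ _ zb vw.
  have -> : f z / (z - v) ^+ 2 - f z / (z - w) ^+ 2 - f z * 2 / (z - w) ^+ 3 * (v - w) =
    f z * (((z - v)^-1 * (z - v)^-1) * ((z - w)^-1 * (z - w)^-1) *
       (3%:R - 2%:R * ((v - w) * (z - w)^-1))) * ((v - w) * (v - w)).
    by field; rewrite nw nv.
  rewrite cabsM [cabs ((v - w) * _)]cabsM expr2 ler_wpM2r ?mulr_ge0 ?cabs_ge0//.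
  have i1 := cabs_inv_le r0 (rw _ zb).
  have := cabs_inv_le r2 (far _ _ zb vw); rewrite invfM invrK mulrC => j1.
  have k1 : cabs (3%:R - 2%:R * ((v - w) * (z - w)^-1)) <= 4.
    have h3 : cabs (3%:R : R[i]) = 3.
      by rewrite -[3%:R](rmorph_nat (real_complex R)) /= expr0n addr0 sqrtr_sqr ger0_norm.
    have h2 : cabs (2%:R : R[i]) = 2.
      by rewrite -[2%:R](rmorph_nat (real_complex R)) /= expr0n addr0 sqrtr_sqr ger0_norm.
    apply: le_trans (cabsB _ _) _; rewrite 2!cabsM h3 h2.
    have : cabs (v - w) * cabs (z - w)^-1 <= r / 2 * r^-1.
      by apply: ler_pM; rewrite ?cabs_ge0// ltW.
    rewrite mulrAC divff ?gt_eqF//; lra.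
  rewrite 5!cabsM (_ : M * 16 * _ =
    M * (((2 * r^-1) * (2 * r^-1)) * (r^-1 * r^-1) * 4)); last by ring.
  do 3 (apply: ler_pM; rewrite ?mulr_ge0 ?cabs_ge0 ?fM//).
    by apply: ler_pM; rewrite ?cabs_ge0.
  by apply: ler_pM; rewrite ?cabs_ge0.
Qed.

Lemma nbCx_proper z : ProperFilter (nbCx z).
Proof.
split; last exact: nbCx_filter.
case=> e e0 H; apply: (H (z + (e / 2)%:C%C)).
  by rewrite addrC addKr /= expr0n addr0 sqrtr_sqr ger0_norm; lra.
rewrite /= -subr_eq0 addrC addKr; apply/eqP => -[]; lra.
Qed.

Lemma cdiff_unique f z k l : cdiff f z k -> cdiff f z l -> k = l.
Proof.
have ? := nbCx_proper z.
move=> [k1 k2] [l1 l2]; apply: complex_eqP.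
  exact: (cvg_unique _ k1 l1).
exact: (cvg_unique _ k2 l2).
Qed.

Definition copen (U : set R[i]) := forall z, U z -> \forall w \near nbC z, U w.

(** Near z0 the integral formula reads f = Phi 1 / J 1, where Phi n and J n integrate
  f / (z - w)^n and 1 / (z - w)^n. By uniqueness f' agrees there with the quotient rule
  applied to this expression, and that only involves differentiable functions. *)
Lemma cdiff_derivative (U : set R[i]) f f' : copen U ->
  (forall z, U z -> cdiff f z (f' z)) -> forall z, U z -> exists l, cdiff f' z l.
Proof.
move=> oU df z0 Uz0.
have /climP/(_ _ ltr01)[d1 d10 d1P] := cdiff_clim (df _ Uz0).
have [d2 d20 d2P] := oU _ Uz0.
(* A square of half-side r lies within distance 2 r < 3 r of its centre, and a point
   within r / 2 of the centre keeps distance r / 2 from the boundary. *)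
pose r := Num.min d1 d2 / 3.
have r0 : 0 < r by rewrite divr_gt0// lt_min d10.
have rd : 3 * r <= d1 /\ 3 * r <= d2.
  by rewrite /r mulrC divfK// !ge_min !lexx orbT.
case: rd => rd1 rd2.
pose x := Re z0; pose y := Im z0.
pose a := x - r; pose b := x + r; pose c := y - r; pose d := y + r.
have inr z : in_rect a b c d z -> cabs (z - z0) < 3 * r.
  rewrite /in_rect /a /b /c /d => /andP[/andP[? ?] /andP[? ?]].
  apply: le_lt_trans (cabs_le_ReIm _) _; rewrite !ReImE -/x -/y.
  have : `|Re z - x| <= r by rewrite ler_norml; apply/andP; split; lra.
  have : `|Im z - y| <= r by rewrite ler_norml; apply/andP; split; lra.
  lra.
have dfr z : in_rect a b c d z -> exists l, cdiff f z l.
  by move=> /inr zr; exists (f' z); apply/df/d2P; lra.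
have ab : a <= b by rewrite /a /b; lra.
have cd : c <= d by rewrite /c /d; lra.
pose M := cabs (f z0) + 1.
have fM z : bd_rect a b c d z -> cabs (f z) <= M.
  move=> /bd_in/inr zr; have := d1P z; have := cabsD (f z - f z0) (f z0).
  by rewrite subrK /M => ? /(_ (lt_le_trans zr rd1)); lra.
have cf : ctn_bd f a b c d by move=> z /bd_in/dfr[l]; exact: cdiff_clim.
have c1 : ctn_bd (fun=> 1 : R[i]) a b c d by move=> z _; exact: clim_cst.
have oneM z : bd_rect a b c d z -> cabs (1 : R[i]) <= 1 by rewrite Normc.normc1.
have r2 : 0 < r / 2 by rewrite divr_gt0.
have close w : cabs (w - z0) < r / 2 ->
    [/\ a < Re w < b, c < Im w < d & forall z, bd_rect a b c d z -> r / 2 <= cabs (z - w)].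
  move=> wz.
  have := le_lt_trans (Re_le_cabs _) wz; have := le_lt_trans (Im_le_cabs _) wz.
  rewrite !ReImE -/x -/y !ltr_norml => /andP[? ?] /andP[? ?].
  rewrite /bd_rect /a /b /c /d.
  split; [by apply/andP; split; lra|by apply/andP; split; lra|] => z /andP[_ zb].
  have := le_trans (ler_norm _) (Re_le_cabs (z - w)).
  have := le_trans (ler_norm _) (Im_le_cabs (z - w)).
  have := le_trans (ler_norm _) (Re_le_cabs (- (z - w))).
  have := le_trans (ler_norm _) (Im_le_cabs (- (z - w))).
  rewrite cabsN !ReImE => h1 h2 h3 h4.
  by case/or4P: zb => /eqP zb; lra.
pose Phi n v := rect (fun z => f z / (z - v) ^+ n) a b c d.
pose J n v := rect (fun z => 1 / (z - v) ^+ n) a b c d.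
have E1 (g : R[i] -> R[i]) v : (fun z => g z / (z - v)) = fun z => g z / (z - v) ^+ 1.
  by apply/funext => z; rewrite expr1.
have kd w : cabs (w - z0) < r / 2 ->
   [/\ cdiff (Phi 1%N) w (Phi 2%N w), cdiff (J 1%N) w (J 2%N w),
    (exists l, cdiff (Phi 2%N) w l), (exists l, cdiff (J 2%N) w l) &
    J 1%N w != 0 /\ f w = Phi 1%N w / J 1%N w].
  move=> wz; have [wab wcd wfar] := close _ wz.
  have [p1 p2] := cauchy_kernel_diff ab cd r2 cf fM wfar.
  have [j1 j2] := cauchy_kernel_diff ab cd r2 c1 oneM wfar.
  have J0 : J 1%N w != 0.
    rewrite /J (_ : (fun z => _) = fun z => (z - w)^-1); first exact: rect_inv_neq0.
    by apply/funext => z; rewrite expr1 div1r.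
  split; [exact: p1|exact: j1|by eexists; exact: p2|by eexists; exact: j2|split => //].
  apply: (mulIf J0); rewrite divfK// /Phi -E1 -(cauchy_formula wab wcd dfr) /J.
  rewrite (_ : (fun z => 1 / _) = fun z => (z - w)^-1)//.
  by apply/funext => z; rewrite expr1 div1r.
have f'E w : cabs (w - z0) < r / 2 ->
    f' w = Phi 2%N w * (J 1%N w)^-1 + Phi 1%N w * (- J 2%N w / J 1%N w ^+ 2).
  move=> wz; have [p1 j1 _ _ [J0 fw]] := kd _ wz.
  have Uw : U w by apply: d2P; lra.
  apply: cdiff_unique (df _ Uw) _.
  apply: cdiff_near (cdiffM p1 (cdiffV J0 j1)).
  exists (r / 2 - cabs (w - z0)); first by lra.
  move=> v vw; have vz : cabs (v - z0) < r / 2.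
    have := cabsD (v - w) (w - z0); rewrite subrKA; lra.
  by have [_ _ _ _ [_ ->]] := kd _ vz.
have z00 : cabs (z0 - z0) < r / 2 by rewrite subrr cabs0.
have [p1 j1 [p2' p2] [j2' j2] [J0 _]] := kd _ z00.
have dJ := cdiffV J0 j1.
eexists; apply: cdiff_near; last first.
  apply: cdiffD; first exact: cdiffM p2 dJ.
  apply: cdiffM p1 _; apply: cdiffM; first exact: cdiffN j2.
  by apply: (@cdiffV _ (fun v => J 1%N v * J 1%N v)); [exact: mulf_neq0|exact: (cdiffM j1 j1)].
by exists (r / 2) => // w /f'E ->; rewrite expr2.
Qed.

End Regularity.

(** * Holomorphic functions in real coordinates *)

Section RealForm.
Context {R : realType}.
Implicit Types (D : set (R * R)) (s r : R).

Lemma is_derive_cvg {V W : normedModType R} (f : V -> W) (x v : V) (l : W) :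
  h^-1 *: (f (h *: v + x) - f x) @[h --> 0^'] --> l -> is_derive x v f l.
Proof.
move=> H; apply: DeriveDef; first by apply/cvg_ex; exists l.
exact: cvg_lim H.
Qed.

Lemma is_derive_mulr {V : normedModType R} (f g : V -> R) (x v : V) (df dg : R) :
  is_derive x v f df -> is_derive x v g dg ->
  is_derive x v (fun y => f y * g y) (df * g x + f x * dg).
Proof.
by move=> ? ?; apply: is_derive_eq; rewrite addrC /GRing.scale /= [g x * _]mulrC.
Qed.

Lemma differentiable_partials (u : R * R -> R) z : differentiable u z ->
  forall e, 0 < e -> \forall w \near nbC (Complex z.1 z.2),
   `|u (Re w, Im w) - u z - ('D_(1, 0) u z * (Re w - z.1) + 'D_(0, 1) u z * (Im w - z.2))|
     <= e * cabs (w - Complex z.1 z.2).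
Proof.
move=> du e e0; rewrite !deriveE//.
have /eqaddoP/(_ _ e0)/nbhs_ballP[d /= d0 dP] := diff_locally du.
exists d => // w wd.
have n1 : `|Re w - z.1| <= cabs (w - Complex z.1 z.2).
  by have := Re_le_cabs (w - Complex z.1 z.2); rewrite !ReImE.
have n2 : `|Im w - z.2| <= cabs (w - Complex z.1 z.2).
  by have := Im_le_cabs (w - Complex z.1 z.2); rewrite !ReImE.
have := dP (Re w - z.1, Im w - z.2).
have hE : (Re w - z.1, Im w - z.2) = (Re w - z.1) *: (1, 0) + (Im w - z.2) *: (0, 1) :> R * R.
  by congr pair; rewrite /= ?scaler0 ?addr0 ?add0r [_ *: _]mulr1.
have L : 'd u z (Re w - z.1, Im w - z.2) =
    'd u z (1, 0) * (Re w - z.1) + 'd u z (0, 1) * (Im w - z.2).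
  have Z (k : R) p : 'd u z (k *: p) = 'd u z p * k by rewrite linearZ [LHS]mulrC.
  by rewrite hE linearD !Z.
have -> : u (Re w, Im w) - u z - ('d u z (1, 0) * (Re w - z.1) + 'd u z (0, 1) * (Im w - z.2)) =
  (u \o shift z - (cst (u z) + 'd u z)) (Re w - z.1, Im w - z.2).
  have hz : (Re w - z.1, Im w - z.2) + z = (Re w, Im w).
    by case: (z) => z1 z2; congr pair; rewrite /= subrK.
  by rewrite /= !fctE /= L hz; ring.
move=> H; apply: le_trans (H _) _; last first.
  by rewrite ler_pM2l//= prod_normE /= ge_max n1 n2.
by split => /=; rewrite /ball /= sub0r normrN; [exact: le_lt_trans n1 wd|exact: le_lt_trans n2 wd].
Qed.

Lemma cdiff_CR (u v : R * R -> R) z : differentiable u z -> differentiable v z ->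
  'D_(1, 0) u z = 'D_(0, 1) v z -> 'D_(0, 1) u z = - 'D_(1, 0) v z ->
  cdiff (fun w => Complex (u (Re w, Im w)) (v (Re w, Im w))) (Complex z.1 z.2)
    (Complex ('D_(1, 0) u z) ('D_(1, 0) v z)).
Proof.
move=> du dv CR1 CR2; apply/cdiffP => e e0.
have e2 : 0 < e / 2 by rewrite divr_gt0.
near=> w.
apply: le_trans (cabs_le_ReIm _) _; rewrite (splitr e) mulrDl !ReImE /=.
apply: lerD.
  have : `|u (Re w, Im w) - u z - ('D_(1, 0) u z * (Re w - z.1) + 'D_(0, 1) u z * (Im w - z.2))|
     <= e / 2 * cabs (w - Complex z.1 z.2).
    by near: w; exact: differentiable_partials.
  by rewrite -surjective_pairing CR2 mulNr.
have : `|v (Re w, Im w) - v z - ('D_(1, 0) v z * (Re w - z.1) + 'D_(0, 1) v z * (Im w - z.2))|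
     <= e / 2 * cabs (w - Complex z.1 z.2).
  by near: w; exact: differentiable_partials.
by rewrite -surjective_pairing -CR1 addrC [X in - X]addrC [X in _ -> `| X | <= _]addrC.
Unshelve. all: by end_near. Qed.

Section FromC.
Variables (f : R[i] -> R[i]) (s r : R) (l : R[i]).
Hypothesis df : cdiff f (Complex s r) l.

Let hline : clim 0^' (fun h : R => (f (Complex (h *: 1 + s) r) - f (Complex s r)) / (h%:C%C)) l.
Proof.
have k : Complex (h *: (1 : R) + s) r @[h --> 0^'] --> nbCx (Complex s r).
  move=> P [d d0 dP]; apply/nbhs_ballP; exists d => //= h; rewrite /ball /= sub0r normrN => hd h0.
  apply: dP.
    apply: le_lt_trans (cabs_le_ReIm _) _; rewrite !ReImE /= subrr normr0 addr0.
    by rewrite [h *: _]mulr1 addrK.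
  apply: contra_neq h0 => -[]; rewrite [h *: _]mulr1 => /eqP; rewrite -subr_eq0 addrK => /eqP //.
apply: clim_near (clim_comp k df); apply: nearW => h /=; congr (_ / _).
by apply: complex_eqP; rewrite !ReImE /= ?subrr// [h *: _]mulr1 addrK.
Qed.

Let vline :
  clim 0^' (fun h : R => (f (Complex s (h *: 1 + r)) - f (Complex s r)) / (Complex 0 h)) l.
Proof.
have k : Complex s (h *: (1 : R) + r) @[h --> 0^'] --> nbCx (Complex s r).
  move=> P [d d0 dP]; apply/nbhs_ballP; exists d => //= h; rewrite /ball /= sub0r normrN => hd h0.
  apply: dP.
    apply: le_lt_trans (cabs_le_ReIm _) _; rewrite !ReImE /= subrr normr0 add0r.
    by rewrite [h *: _]mulr1 addrK.
  apply: contra_neq h0 => -[]; rewrite [h *: _]mulr1 => /eqP; rewrite -subr_eq0 addrK => /eqP //.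
apply: clim_near (clim_comp k df); apply: nearW => h /=; congr (_ / _).
by apply: complex_eqP; rewrite !ReImE /= ?subrr// [h *: _]mulr1 addrK.
Qed.

Lemma cdiff_ReIm_partials :
  [/\ is_derive s 1 (fun x : R => Re (f (Complex x r))) (Re l),
      is_derive s 1 (fun x : R => Im (f (Complex x r))) (Im l),
      is_derive r 1 (fun x : R => Re (f (Complex s x))) (- Im l) &
      is_derive r 1 (fun x : R => Im (f (Complex s x))) (Re l)].
Proof.
have [h1 h2] := hline; have [v1 v2] := vline.
have sq (h : R) : h * (h ^+ 2)^-1 = h^-1.
  by have [->|h0] := eqVneq h 0; [rewrite invr0 mul0r|field].
split; apply: is_derive_cvg.
- apply: cvg_trans h1; apply: near_eq_cvg; apply: nearW => h.
  by rewrite !ReImE ReV ImV /= oppr0 mul0r mulr0 subr0 expr0n addr0 sq mulrC.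
- apply: cvg_trans h2; apply: near_eq_cvg; apply: nearW => h.
  by rewrite !ReImE ReV ImV /= oppr0 mul0r mulr0 add0r expr0n addr0 sq mulrC.
- move/cvgN: v2; apply: cvg_trans; apply: near_eq_cvg; apply: nearW => h.
  rewrite /= !fctE !ReImE ReV ImV /= mul0r mulr0 addr0 expr0n add0r.
  by rewrite mulNr sq mulrN opprK mulrC.
- apply: cvg_trans v1; apply: near_eq_cvg; apply: nearW => h.
  rewrite !ReImE ReV ImV /= mul0r mulr0 expr0n !add0r.
  by rewrite mulNr sq mulrN opprK mulrC.
Qed.

Lemma cdiff_ReIm_continuous :
  {for (s, r), continuous (fun p : R * R => Re (f (Complex p.1 p.2)))} /\
  {for (s, r), continuous (fun p : R * R => Im (f (Complex p.1 p.2)))}.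
Proof.
have k : Complex p.1 p.2 @[p --> nbhs (s, r)] --> nbC (Complex s r).
  move=> P [d d0 dP]; apply/nbhs_ballP; exists (d / 2); first by rewrite /= divr_gt0.
  move=> [p1 p2] [/=]; rewrite /ball /= => h1 h2; apply: dP.
  apply: le_lt_trans (cabs_le_ReIm _) _; rewrite !ReImE /= (splitr d).
  by rewrite distrC [X in _ + X]distrC ltrD.
by have [] := clim_comp k (cdiff_clim df).
Qed.

End FromC.

End RealForm.

(** * The Cauchy-Riemann system satisfied by the radial operators *)

Section GeneralizedCR.
Context {R : realType}.
Variable (U : set (R * R)).
Hypothesis U_open : open U.

(** a 0 and b 0 are the two unknown functions of s and r, and a j, b j their derivatives of
  order j in s. Keeping all orders in s at once makes the system closed under d_r and
  under multiplication by 1 / r, so that mixed partial derivatives never have to be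
  exchanged. The equation for d_r b reads d_s a = d_r b + (2 n / r) b. *)
Record radial_CR (n : nat) (a b : nat -> R -> R -> R) : Prop := RadialCR {
  rcr_ds_a : forall j s r, U (s, r) -> is_derive s 1 (fun x => a j x r) (a j.+1 s r);
  rcr_ds_b : forall j s r, U (s, r) -> is_derive s 1 (fun x => b j x r) (b j.+1 s r);
  rcr_dr_a : forall j s r, U (s, r) -> is_derive r 1 (a j s) (- b j.+1 s r);
  rcr_dr_b : forall j s r, U (s, r) ->
    is_derive r 1 (b j s) (a j.+1 s r - (2 * n%:R) / r * b j s r);
  rcr_cont_a : forall j s r, U (s, r) ->
    {for (s, r), continuous (fun p : R * R => a j p.1 p.2)};
  rcr_cont_b : forall j s r, U (s, r) ->
    {for (s, r), continuous (fun p : R * R => b j p.1 p.2)} }.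

Lemma open_copen : copen [set z : R[i] | U (Re z, Im z)].
Proof.
move=> z /= Uz; have /nbhs_ballP[d /= d0 dP] := open_nbhs_nbhs (conj U_open Uz).
exists d => // w wd; apply: dP; split => /=; rewrite /ball /= distrC -?ReN -?ImN -?ReD -?ImD.
  exact: le_lt_trans (Re_le_cabs _) wd.
exact: le_lt_trans (Im_le_cabs _) wd.
Qed.

(** For n = 0 the system says that a j + i b j is the j-th complex derivative, whose
  existence for all j is [cdiff_derivative]; derivation in r multiplies by i. *)
Lemma radial_CR_holomorphic (u v : R * R -> R) :
  (forall z, U z -> [/\ differentiable u z, differentiable v z,
     'D_(1, 0) u z = 'D_(0, 1) v z & 'D_(0, 1) u z = - 'D_(1, 0) v z]) ->
  exists a b, [/\ radial_CR 0 a b, (forall s r, a 0%N s r = u (s, r)) &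
    (forall s r, b 0%N s r = v (s, r))].
Proof.
move=> H.
(* A choice of the complex derivative, with default value 0 where there is none. *)
pose dd (g : R[i] -> R[i]) z := xget 0 [set l | cdiff g z l].
pose f j := iter j dd (fun w => Complex (u (Re w, Im w)) (v (Re w, Im w))).
have df j z : U (Re z, Im z) -> cdiff (f j) z (f j.+1 z).
  move=> Uz; rewrite /= /dd; apply: (@xgetPex _ 0 [set l | cdiff (f j) z l]).
  elim: j z Uz => [|j IH] z Uz.
    have [du dv CR1 CR2] := H _ Uz; eexists.
    have E : z = Complex (Re z) (Im z) by case: (z).
    rewrite [X in cdiff _ X]E; exact: (cdiff_CR du dv CR1 CR2).
  apply: cdiff_derivative open_copen _ _ Uz => w Uw.
  exact: (@xgetPex _ 0 [set l | cdiff (f j) w l] (IH _ Uw)).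
exists (fun j s r => Re (f j (Complex s r))), (fun j s r => Im (f j (Complex s r))).
split => //; split=> j s r Us; have dfj := df j (Complex s r) Us;
  have [d1 d2 d3 d4] := cdiff_ReIm_partials dfj => //.
  by apply: is_derive_eq d4 _; rewrite mulr0n mulr0 !mul0r subr0.
  by have [] := cdiff_ReIm_continuous dfj.
by have [] := cdiff_ReIm_continuous dfj.
Qed.

Hypothesis U_pos : forall s r, U (s, r) -> 0 < r.

Lemma open_near_snd s r : U (s, r) -> \forall x \near r, U (s, x).
Proof.
move=> Us; have /nbhs_ballP[d /= d0 dP] := open_nbhs_nbhs (conj U_open Us).
apply/nbhs_ballP; exists d => // x xd; apply: dP; split => //=; exact: ballxx.
Qed.

Lemma is_derive_invr (r : R) : 0 < r -> is_derive r 1 (fun x : R => x^-1) (- (r ^+ 2)^-1).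
Proof.
move=> r0; have r1 : r != 0 by rewrite gt_eqF.
apply: DeriveDef; first exact: derivableV.
by rewrite (@deriveV _ _ id)//= derive_id /GRing.scale /= mulr1.
Qed.

(** The new pair is (r^-1 d_r a, d_r (r^-1 b)), rewritten with the old equations as
  (- r^-1 d_s b, r^-1 d_s a - (2 n + 1) r^-2 b). *)
Lemma radial_CR_succ n a b : radial_CR n a b ->
  radial_CR n.+1 (fun j s r => - b j.+1 s r * r^-1)
    (fun j s r => a j.+1 s r * r^-1 - (2 * n%:R + 1) * (b j s r * (r^-1 * r^-1))).
Proof.
move=> [sa sb ra rb ca cb]; split=> j s r Us; have r0 := U_pos Us;
  have r1 : r != 0 by rewrite gt_eqF.
all: have V : (p.2 : R)^-1 @[p --> (s, r)] --> r^-1 by apply: cvgV => //; exact: cvg_snd.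
all: have hc (k x : R) : is_derive x 1 (fun _ : R => k) 0 by exact: is_derive_cst.
all: have hv := is_derive_invr r0.
- apply: (is_derive_eq (is_derive_mulr (is_deriveN (sb j.+1 s r Us)) (hc _ _))).
  by rewrite mulr0 addr0.
- apply: (is_derive_eq (is_deriveB (is_derive_mulr (sa j.+1 s r Us) (hc _ _))
    (is_derive_mulr (hc _ _) (is_derive_mulr (sb j s r Us) (hc _ _))))).
  by ring.
- apply: (is_derive_eq (is_derive_mulr (is_deriveN (rb j.+1 s r Us)) hv)).
  by rewrite /= !fctE; field.
- apply: (is_derive_eq (is_deriveB (is_derive_mulr (ra j.+1 s r Us) hv)
    (is_derive_mulr (hc _ _) (is_derive_mulr (rb j s r Us) (is_derive_mulr hv hv))))).
  by rewrite -[n.+1%:R]natr1; field.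
- by apply: cvgM; [apply: cvgN; exact: cb|exact: V].
- apply: cvgB; first by apply: cvgM; [exact: ca|exact: V].
  apply: cvgM; first exact: cvg_cst.
  by apply: cvgM; [exact: cb|apply: cvgM; exact: V].
Qed.

End GeneralizedCR.

(** * Profiles of V_n f *)

Section Profiles.
Context {R : realType}.

Lemma is_derive1E (f : R -> R) (x l : R) : is_derive x 1 f l -> derive1 f x = l.
Proof. by move=> fl; rewrite derive1E derive_val. Qed.

Lemma radial_CR_iter (U : set (R * R)) (U_open : open U)
    (U_pos : forall s r, U (s, r) -> 0 < r) (u v : R * R -> R) :
  (forall z, U z -> [/\ differentiable u z, differentiable v z,
     'D_(1, 0) u z = 'D_(0, 1) v z & 'D_(0, 1) u z = - 'D_(1, 0) v z]) ->
  forall n, exists a b, radial_CR U n a b /\ forall s r, U (s, r) ->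
    iter n (@inv_r_d R) (fun x => u (s, x)) r = a 0%N s r /\
    iter n (@d_inv_r R) (fun x => v (s, x)) r = b 0%N s r.
Proof.
move=> /(radial_CR_holomorphic U_open)[a0 [b0 [g0 au bv]]].
elim=> [|n [a [b [gn IH]]]].
  by exists a0, b0; split => // s r _ /=; rewrite au bv.
exists (fun j s r => - b j.+1 s r * r^-1),
  (fun j s r => a j.+1 s r * r^-1 - (2 * n%:R + 1) * (b j s r * (r^-1 * r^-1))).
split; first exact: radial_CR_succ.
move=> s r Us; have r0 := U_pos _ _ Us; have r1 : r != 0 by rewrite gt_eqF.
have nr := open_near_snd U_open Us.
split; rewrite iterS.
  rewrite /inv_r_d mulrC; congr (_ * _); apply: is_derive1E.
  apply: near_eq_is_derive (rcr_dr_a gn 0 Us).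
  by near=> x; rewrite (IH s x _).1//; near: x.
rewrite /d_inv_r; apply: is_derive1E.
apply: (@near_eq_is_derive _ _ _ (fun x => b 0%N s x * x^-1)).
  by near=> x; rewrite (IH s x _).2//; near: x.
apply: is_derive_eq (is_derive_mulr (rcr_dr_b gn 0 Us) (is_derive_invr r0)) _.
by field.
Unshelve. all: by end_near. Qed.

(** The part of [radial_CR n] that a first-order operator sees, for all the coordinates of a
  Clifford-valued pair; As and Bs stand for the derivatives of A and B in s. *)
Record profile (m n : nat) (U : set (R * R)) (A B As Bs : R -> R -> clifford R m) :
    Prop := Profile {
  prof_ds_A : forall S s r, U (s, r) ->
    is_derive s 1 (fun x => cl_coef S (A x r)) (cl_coef S (As s r));
  prof_ds_B : forall S s r, U (s, r) ->
    is_derive s 1 (fun x => cl_coef S (B x r)) (cl_coef S (Bs s r));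
  prof_dr_A : forall S s r, U (s, r) ->
    is_derive r 1 (fun x => cl_coef S (A s x)) (- cl_coef S (Bs s r));
  prof_dr_B : forall S s r, U (s, r) ->
    is_derive r 1 (fun x => cl_coef S (B s x))
      (cl_coef S (As s r) - (2 * n%:R) / r * cl_coef S (B s r));
  prof_cont_B : forall S s r, U (s, r) ->
    {for (s, r), continuous (fun p : R * R => cl_coef S (B p.1 p.2))} }.

Lemma open_upper_half (D : set (R * R)) : open D -> open [set z | D z /\ 0 < z.2].
Proof.
move=> D_open; apply: openI => //.
apply: (@open_comp _ _ snd [set x : R | 0 < x]); last exact: open_gt.
by move=> z _; exact: cvg_snd.
Qed.

Lemma slice_profile m (D : set (R * R)) (alpha beta : R * R -> clifford R m) :
  open D -> holomorphic D alpha beta ->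
  forall n, exists A B As Bs,
    profile n [set z | D z /\ 0 < z.2] A B As Bs /\
    forall s r, D (s, r) -> 0 < r ->
      cwise (iter n (@inv_r_d R)) (fun x => alpha (s, x)) r = A s r /\
      cwise (iter n (@d_inv_r R)) (fun x => beta (s, x)) r = B s r.
Proof.
move=> D_open hol n; set U := [set z | _].
have U_open : open U by exact: open_upper_half.
have U_pos s r : U (s, r) -> 0 < r by case.
have /choice[a /choice[b ab]] : forall S : {set 'I_m}, exists a, exists b, radial_CR U n a b /\
    forall s r, U (s, r) ->
    iter n (@inv_r_d R) (fun x => cl_coef S (alpha (s, x))) r = a 0%N s r /\
    iter n (@d_inv_r R) (fun x => cl_coef S (beta (s, x))) r = b 0%N s r.
  move=> S; apply: (@radial_CR_iter _ U_open U_pos (fun z => cl_coef S (alpha z))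
    (fun z => cl_coef S (beta z)) _ n) => z [Dz _].
  have [dab CR1 CR2] := hol _ Dz; have [da db] := dab S; split => //.
    by have := congr1 (cl_coef S) CR1; rewrite /d_s /d_t /cwise !cl_mkE.
  have := congr1 (cl_coef S) CR2; rewrite /d_s /d_t /cwise -scaleN1r cl_coefZ !cl_mkE.
  by rewrite mulN1r.
exists (fun s r => cl_mk (fun S => a S 0%N s r)), (fun s r => cl_mk (fun S => b S 0%N s r)),
  (fun s r => cl_mk (fun S => a S 1%N s r)), (fun s r => cl_mk (fun S => b S 1%N s r)).
split.
  split=> S s r Us; have [g _] := ab S; rewrite ?cl_mkE;
    try (under eq_fun do rewrite cl_mkE).
  - exact: rcr_ds_a g 0 _ _ Us.
  - exact: rcr_ds_b g 0 _ _ Us.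
  - exact: rcr_dr_a g 0 _ _ Us.
  - exact: rcr_dr_b g 0 _ _ Us.
  - rewrite (_ : (fun p => _) = (fun p : R * R => b S 0%N p.1 p.2)).
      exact: rcr_cont_b g 0 _ _ Us.
    by apply/funext => p; rewrite cl_mkE.
move=> s r Ds r0; split; apply: cl_coefP => S; rewrite /cwise !cl_mkE.
  by rewrite ((ab S).2 s r _).1.
by rewrite ((ab S).2 s r _).2.
Qed.

End Profiles.

(** * Clifford vectors and reflections *)

Lemma cl_coefN {R : realType} m S (c : clifford R m) : cl_coef S (- c) = - cl_coef S c.
Proof. by rewrite /cl_coef ffunE. Qed.

Section CliffordVectors.
Context {R : realType} {m : nat}.
Implicit Types (x y a : 'rV[R]_m) (c : clifford R m).

Lemma cl_vecD x y : cl_vec (x + y) = cl_vec x + cl_vec y.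
Proof. by rewrite /cl_vec -big_split; apply: eq_bigr => j _; rewrite mxE scalerDl. Qed.

Lemma cl_vecZ k x : cl_vec (k *: x) = k *: cl_vec x.
Proof. by rewrite /cl_vec scaler_sumr; apply: eq_bigr => j _; rewrite mxE scalerA. Qed.

Lemma cl_vecB x y : cl_vec (x - y) = cl_vec x - cl_vec y.
Proof. by rewrite cl_vecD -scaleN1r cl_vecZ scaleN1r. Qed.

(** Twice the square is a sum of the anticommutators of the e_i, and only i = j survives. *)
Lemma cl_vec_sqr x : cl_vec x * cl_vec x = - (dotv x x)%:A.
Proof.
have dbl (z : clifford R m) : z + z = 2 *: z by rewrite -mulr2n scaler_nat.
have n2 : (2 : R) != 0 by rewrite pnatr_eq0.
apply: (scalerI n2); rewrite -dbl.
have E : cl_vec x * cl_vec x =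
    \sum_(i < m) \sum_(j < m) (x 0 i * x 0 j) *: (cl_gen R i * cl_gen R j).
  rewrite {1}/cl_vec mulr_suml; apply: eq_bigr => i _.
  rewrite /cl_vec mulr_sumr; apply: eq_bigr => j _.
  by rewrite -scalerAl -scalerAr scalerA.
rewrite {1}E exchange_big /= E -big_split /= scalerN scalerA /dotv.
rewrite mulr_sumr scaler_suml -sumrN; apply: eq_bigr => i _.
rewrite -big_split /= (bigD1 i)//= big1 ?addr0.
  by rewrite cl_gen_sqr !scalerN -opprD dbl scalerA.
move=> j ji; rewrite (cl_gen_anticomm R ji) [x 0 j * _]mulrC scalerN.
by rewrite addNr.
Qed.

Lemma dotvZl k x y : dotv (k *: x) y = k * dotv x y.
Proof. by rewrite /dotv mulr_sumr; apply: eq_bigr => i _; rewrite mxE mulrA. Qed.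

Lemma dotvC x y : dotv x y = dotv y x.
Proof. by apply: eq_bigr => i _; rewrite mulrC. Qed.

Lemma dotvDl x y a : dotv (x + y) a = dotv x a + dotv y a.
Proof. by rewrite /dotv -big_split; apply: eq_bigr => i _; rewrite mxE mulrDl. Qed.

Lemma dotvDr x y a : dotv a (x + y) = dotv a x + dotv a y.
Proof. by rewrite dotvC dotvDl !(dotvC a). Qed.

Lemma dotvZr k x y : dotv y (k *: x) = k * dotv y x.
Proof. by rewrite dotvC dotvZl dotvC. Qed.

Lemma dotv_ge0 x : 0 <= dotv x x.
Proof. by apply: sumr_ge0 => i _; rewrite -expr2 sqr_ge0. Qed.

Lemma dotv_delta x j : dotv x (delta_mx 0 j) = x 0 j.
Proof.
rewrite /dotv (bigD1 j)//= mxE !eqxx mulr1 big1 ?addr0// => i ij.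
by rewrite mxE (negbTE ij) andbF mulr0.
Qed.

Lemma sqr_enorm x : enorm x ^+ 2 = dotv x x.
Proof. by rewrite /enorm sqr_sqrtr// dotv_ge0. Qed.

Lemma enorm_ge0 x : 0 <= enorm x. Proof. exact: sqrtr_ge0. Qed.

Lemma enorm_gt0 x : (0 < enorm x) = (x != 0).
Proof.
rewrite lt_neqAle enorm_ge0 andbT eq_sym; congr (~~ _).
rewrite /enorm sqrtr_eq0; apply/idP/eqP => [x0|->]; last first.
  by rewrite /dotv big1// => i _; rewrite mxE mul0r.
have : dotv x x == 0 by rewrite eq_le x0 dotv_ge0.
rewrite psumr_eq0 => [/allP/= h|i _]; last by rewrite -expr2 sqr_ge0.
apply/rowP => i; rewrite mxE; have := h i (mem_index_enum _).
by rewrite -expr2 sqrf_eq0 => /eqP.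
Qed.

Lemma enormZ k x : enorm (k *: x) = `|k| * enorm x.
Proof.
by rewrite /enorm dotvZl dotvZr mulrA -expr2 sqrtrM ?sqr_ge0// sqrtr_sqr.
Qed.

Lemma refl_normalized a x : dotv a a = 2 -> refl a x = x - dotv a x *: a.
Proof.
move=> a2; rewrite /refl sqr_enorm a2; congr (_ - _ *: _).
by rewrite mulrAC divff ?mul1r// pnatr_eq0.
Qed.

Lemma enorm_refl a x : dotv a a = 2 -> enorm (refl a x) = enorm x.
Proof.
move=> a2; rewrite refl_normalized// /enorm -scaleNr; congr Num.sqrt.
rewrite dotvDl !dotvDr !dotvZl !dotvZr a2 (dotvC x a); ring.
Qed.

End CliffordVectors.

(** * Directional derivatives of Clifford-valued functions *)

Section CliffordCalculus.
Context {R : realType} {m : nat} {V : normedModType R}.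
Implicit Types (g h : V -> clifford R m) (x v : V).

Definition cl_is_derive x v g dg :=
  forall S, is_derive x v (fun y => cl_coef S (g y)) (cl_coef S dg).

Lemma is_derive_bigsum (I : Type) (r : seq I) (F : I -> V -> R) dF x v :
  (forall i, is_derive x v (F i) (dF i)) ->
  is_derive x v (fun y => \sum_(i <- r) F i y) (\sum_(i <- r) dF i).
Proof.
move=> H; elim: r => [|i r IH].
  by rewrite big_nil; under eq_fun do rewrite big_nil; exact: is_derive_cst.
rewrite big_cons; under eq_fun do rewrite big_cons.
exact: is_deriveD.
Qed.

Lemma cl_is_deriveD g h x v dg dh : cl_is_derive x v g dg -> cl_is_derive x v h dh ->
  cl_is_derive x v (fun y => g y + h y) (dg + dh).
Proof.
move=> Hg Hh S; rewrite cl_coefD; under eq_fun do rewrite cl_coefD; exact: is_deriveD.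
Qed.

Lemma cl_is_deriveMl c g x v dg : cl_is_derive x v g dg ->
  cl_is_derive x v (fun y => c * g y) (c * dg).
Proof.
move=> Hg S; have mE (z : clifford R m) : cl_coef S (c * z) = cl_coef S (cl_mul c z) by [].
rewrite mE cl_mulE; under eq_fun do rewrite mE cl_mulE.
have hc (k : R) : is_derive x v (fun _ : V => k) 0 by exact: is_derive_cst.
apply: is_derive_bigsum => A.
apply: (is_derive_eq (is_derive_mulr (hc _) (is_derive_mulr (hc _) (Hg _)))).
by rewrite /=; ring.
Qed.

Lemma cl_is_deriveZ (f : V -> R) g x v df dg : is_derive x v f df -> cl_is_derive x v g dg ->
  cl_is_derive x v (fun y => f y *: g y) (df *: g x + f x *: dg).
Proof.
move=> Hf Hg S; rewrite cl_coefD !cl_coefZ; under eq_fun do rewrite cl_coefZ.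
exact: is_derive_mulr.
Qed.

Lemma cl_is_derive_sum (I : Type) (r : seq I) (g : I -> V -> clifford R m) dg x v :
  (forall i, cl_is_derive x v (g i) (dg i)) ->
  cl_is_derive x v (fun y => \sum_(i <- r) g i y) (\sum_(i <- r) dg i).
Proof.
move=> H; elim: r => [|i r IH].
  rewrite big_nil => S; under eq_fun do rewrite big_nil.
  by rewrite /cl_coef ffunE; exact: is_derive_cst.
rewrite big_cons (_ : (fun y => _) = (fun y => g i y + \sum_(j <- r) g j y)).
  exact: cl_is_deriveD.
by apply/funext => y; rewrite big_cons.
Qed.

Lemma cl_is_derive_near g h x v dg : (\forall y \near x, g y = h y) ->
  cl_is_derive x v g dg -> cl_is_derive x v h dg.
Proof.
move=> gh Hg S; apply: near_eq_is_derive (Hg S).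
by apply: filterS gh => y ->.
Qed.

Lemma cl_is_deriveE g x v dg : cl_is_derive x v g dg ->
  cwise (fun phi : V -> R => 'D_v phi) g x = dg.
Proof.
by move=> Hg; apply: cl_coefP => S; rewrite /cwise cl_mkE; have Hs := Hg S; exact: derive_val.
Qed.

(** Reduces directional derivatives to functions of one real variable. *)
Lemma is_derive_line (f : V -> R) x v l :
  is_derive (0 : R) 1 (fun t : R => f (t *: v + x)) l -> is_derive x v f l.
Proof.
move=> [H <-]; split; first exact: (iffRL (derivable1P f x v) H).
rewrite /derive; apply: (congr1 (fun g : R -> R => lim (g @ 0^'))); apply/funext => t /=.
by rewrite addr0 scale0r add0r [_%:A]mulr1.
Qed.

End CliffordCalculus.

Lemma cvg_sumR {R : realType} {T I : Type} (F : set_system T) {FF : Filter F}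
    (r : seq I) (f : I -> T -> R) (l : I -> R) :
  (forall i, f i x @[x --> F] --> l i) ->
  \sum_(i <- r) f i x @[x --> F] --> \sum_(i <- r) l i.
Proof.
move=> H; elim: r => [|i r IH].
  by rewrite big_nil; under eq_fun do rewrite big_nil; exact: cvg_cst.
rewrite big_cons; under eq_fun do rewrite big_cons; exact: cvgD.
Qed.

Section Radial.
Context {R : realType} {m : nat}.
Implicit Types (x : paravec R m).

Lemma is_derive_dir0 (phi : R -> R -> R) x l :
  is_derive x.1 1 (fun s => phi s (enorm x.2)) l ->
  is_derive x (dir0 R m) (fun y => phi y.1 (enorm y.2)) l.
Proof.
move=> H; apply: is_derive_line.
rewrite (_ : (fun h => _) = (fun s => phi s (enorm x.2)) \o shift x.1); last first.
  by apply/funext => h /=; rewrite scaler0 add0r [_ *: _]mulr1.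
rewrite -[l]mulr1; apply: is_derive1_comp; last exact: is_derive_shift.
by rewrite /= add0r.
Qed.

(** enorm is the square root of the quadratic polynomial t^2 + 2 x_j t + |x|^2 on the line
  through x in direction e_j. *)
Lemma is_derive_enorm (x : 'rV[R]_m) (j : 'I_m) : x != 0 ->
  is_derive (0 : R) 1 (fun h : R => enorm (h *: delta_mx 0 j + x)) (x 0 j / enorm x).
Proof.
move=> x0; have r0 : 0 < enorm x by rewrite enorm_gt0.
have d0 : 0 < dotv x x by rewrite -sqr_enorm exprn_gt0.
pose q (h : R) := h * h + (2 * x 0 j) * h + dotv x x.
have qE h : dotv (h *: delta_mx 0 j + x) (h *: delta_mx 0 j + x) = q h.
  rewrite dotvDl !dotvDr !dotvZl !dotvZr [dotv (delta_mx _ _) x]dotvC !dotv_delta.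
  by rewrite mxE !eqxx /q /=; ring.
rewrite (_ : (fun h => _) = Num.sqrt \o q); last by apply/funext => h; rewrite /enorm qE.
have q0 : q 0 = dotv x x by rewrite /q; ring.
have dq : is_derive (0 : R) 1 q (2 * x 0 j).
  have i := @is_derive_id _ R^o 0 1.
  have hc (k y : R) : is_derive y 1 (fun _ : R => k) 0 by exact: is_derive_cst.
  apply: (is_derive_eq (is_deriveD (is_deriveD (is_derive_mulr i i)
     (is_derive_mulr (hc (2 * x 0 j) _) i)) (hc (dotv x x) _))).
  by rewrite /=; ring.
have ds : is_derive (q 0) 1 Num.sqrt (2 * Num.sqrt (q 0))^-1 by apply: is_derive1_sqrt; rewrite q0.
apply: is_derive_eq (is_derive1_comp ds dq) _.
rewrite q0 -/(enorm x); have ? : enorm x != 0 by rewrite gt_eqF.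
by field.
Qed.

Lemma is_derive_dirv (phi : R -> R -> R) x (j : 'I_m) l : x.2 != 0 ->
  is_derive (enorm x.2) 1 (phi x.1) l ->
  is_derive x (dirv R j) (fun y => phi y.1 (enorm y.2)) (x.2 0 j / enorm x.2 * l).
Proof.
move=> x0 H; apply: is_derive_line.
rewrite (_ : (fun h => _) = phi x.1 \o (fun h : R => enorm (h *: delta_mx 0 j + x.2))); last first.
  by apply/funext => h /=; rewrite scaler0 add0r.
rewrite mulrC; apply: is_derive1_comp; last exact: is_derive_enorm.
by rewrite scale0r add0r.
Qed.

Lemma is_derive_coord_dirv x (i j : 'I_m) :
  is_derive x (dirv R j) (fun y => y.2 0 i) (i == j)%:R.
Proof.
apply: is_derive_line.
rewrite (_ : (fun h => _) = (fun h : R => h * (i == j)%:R + x.2 0 i)); last first.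
  by apply/funext => h; rewrite /= !mxE ?eqxx.
have id0 := @is_derive_id _ R^o 0 1.
have hc (k y : R) : is_derive y 1 (fun _ : R => k) 0 by exact: is_derive_cst.
apply: (is_derive_eq (is_deriveD (is_derive_mulr id0 (hc _ _)) (hc _ _))).
by rewrite /=; ring.
Qed.

Lemma is_derive_coord_dir0 x (i : 'I_m) :
  is_derive x (dir0 R m) (fun y => y.2 0 i) 0.
Proof.
apply: is_derive_line.
rewrite (_ : (fun h => _) = cst (x.2 0 i)); first exact: is_derive_cst.
by apply/funext => h; rewrite /= scaler0 add0r.
Qed.

Lemma cl_is_derive_radial_dir0 (G : R -> R -> clifford R m) dG x :
  (forall S, is_derive x.1 1 (fun s => cl_coef S (G s (enorm x.2))) (cl_coef S dG)) ->
  cl_is_derive x (dir0 R m) (fun y => G y.1 (enorm y.2)) dG.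
Proof. by move=> H S; apply: (is_derive_dir0 (phi := fun s r => cl_coef S (G s r))). Qed.

Lemma cl_is_derive_radial_dirv (G : R -> R -> clifford R m) dG x (j : 'I_m) : x.2 != 0 ->
  (forall S, is_derive (enorm x.2) 1 (fun r => cl_coef S (G x.1 r)) (cl_coef S dG)) ->
  cl_is_derive x (dirv R j) (fun y => G y.1 (enorm y.2)) ((x.2 0 j / enorm x.2) *: dG).
Proof.
move=> x0 H S; rewrite cl_coefZ.
by apply: (is_derive_dirv (phi := fun s r => cl_coef S (G s r))).
Qed.

Lemma cl_is_derive_vecM (h : paravec R m -> clifford R m) x v (w : 'rV[R]_m) dh :
  (forall i, is_derive x v (fun y => y.2 0 i) (w 0 i)) ->
  cl_is_derive x v h dh ->
  cl_is_derive x v (fun y => cl_vec y.2 * h y) (cl_vec w * h x + cl_vec x.2 * dh).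
Proof.
move=> Hc Hh.
have E (c : clifford R m) (z : 'rV[R]_m) : cl_vec z * c = \sum_i z 0 i *: (cl_gen R i * c).
  by rewrite /cl_vec mulr_suml; apply: eq_bigr => i _; rewrite -scalerAl.
rewrite !E -big_split (_ : (fun y => _) =
    (fun y : paravec R m => \sum_i y.2 0 i *: (cl_gen R i * h y))).
  by apply: cl_is_derive_sum => i; exact: (cl_is_deriveZ (Hc i) (cl_is_deriveMl _ Hh)).
by apply/funext => y; rewrite E.
Qed.

Lemma continuous_enorm : continuous (@enorm R m).
Proof.
move=> x; have c : dotv y y @[y --> x] --> dotv x x.
  apply: (@cvg_sumR _ _ _ (nbhs x) _ _ (fun j (y : 'rV[R]_m) => y 0 j * y 0 j)) => j.
  by apply: cvgM; exact: coord_continuous.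
exact: (cvg_comp _ _ c (@sqrt_continuous R _)).
Qed.

Lemma cvg_paravec_polar x : (y.1, enorm y.2) @[y --> x] --> (x.1, enorm x.2).
Proof.
have c1 : y.1 @[y --> x] --> x.1 by case: x => x1 x2; exact: cvg_fst.
have c : y.2 @[y --> x] --> x.2 by case: x {c1} => x1 x2; exact: cvg_snd.
have c2 := cvg_comp _ _ c (@continuous_enorm _).
exact: (@cvg_pair _ _ _ _ _ _ _ _ _ _ _ c1 c2).
Qed.

End Radial.

(** * The Cauchy-Riemann operator *)

Section MonogenicProfile.
Context {R : realType} {m : nat}.
Variables (n : nat) (U : set (R * R)) (A B As Bs : R -> R -> clifford R m).
Hypothesis U_open : open U.
Hypothesis U_pos : forall s r, U (s, r) -> 0 < r.
Hypothesis AB : profile n U A B As Bs.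
Variable g : paravec R m -> clifford R m.
Implicit Types (x y : paravec R m) (a : 'rV[R]_m).

Definition polar_dom : set (paravec R m) := [set x | U (x.1, enorm x.2)].

Hypothesis gE : forall x, polar_dom x ->
  g x = A x.1 (enorm x.2) + cl_vec x.2 * ((enorm x.2)^-1 *: B x.1 (enorm x.2)).

(* db is the derivative of b in r, as the system prescribes it. *)
Let b s r : clifford R m := r^-1 *: B s r.
Let db s r : clifford R m := r^-1 *: (As s r - (2 * n%:R + 1) *: b s r).

Lemma polar_dom_near x : polar_dom x -> \forall y \near x, polar_dom y.
Proof.
move=> Ux; apply: (@cvg_paravec_polar R m x); exact: (open_nbhs_nbhs (conj U_open Ux)).
Qed.

Section AtPoint.
Variable x : paravec R m.
Hypothesis Ux : polar_dom x.
Let r := enorm x.2.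
Let s := x.1.
Let w := cl_vec x.2.

Let r0 : 0 < r. Proof. exact: U_pos Ux. Qed.
Let x0 : x.2 != 0. Proof. by rewrite -enorm_gt0; exact: r0. Qed.

Lemma derive_g_dir0 : cl_is_derive x (dir0 R m) g (As s r + w * (r^-1 *: Bs s r)).
Proof.
apply: (@cl_is_derive_near _ _ _ (fun y => A y.1 (enorm y.2) + cl_vec y.2 * b y.1 (enorm y.2))).
  by apply: filterS (polar_dom_near Ux) => y /gE ->.
apply: cl_is_deriveD.
  by apply: cl_is_derive_radial_dir0 => S; exact: prof_ds_A AB _ _ _ Ux.
rewrite -[w * _]add0r -(mul0r (b s r)).
have -> : (0 : clifford R m) = cl_vec (0 : 'rV[R]_m).
  by rewrite /cl_vec big1// => i _; rewrite mxE scale0r.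
apply: (cl_is_derive_vecM (h := fun y => b y.1 (enorm y.2))).
  by move=> i; rewrite mxE; exact: is_derive_coord_dir0.
apply: cl_is_derive_radial_dir0 => S; rewrite cl_coefZ; under eq_fun do rewrite cl_coefZ.
apply: is_derive_eq; first apply: is_deriveZ; first exact: (prof_ds_B AB S Ux).
by [].
Qed.

Lemma derive_g_dirv j : cl_is_derive x (dirv R j) g
  ((x.2 0 j / r) *: (- Bs s r) + (cl_gen R j * b s r + w * ((x.2 0 j / r) *: db s r))).
Proof.
apply: (@cl_is_derive_near _ _ _ (fun y => A y.1 (enorm y.2) + cl_vec y.2 * b y.1 (enorm y.2))).
  by apply: filterS (polar_dom_near Ux) => y /gE ->.
apply: cl_is_deriveD.
  apply: cl_is_derive_radial_dirv => // S; rewrite cl_coefN.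
  exact: (prof_dr_A AB S Ux).
have -> : cl_gen R j = cl_vec (delta_mx 0 j : 'rV[R]_m).
  rewrite /cl_vec (bigD1 j)//= mxE !eqxx scale1r big1 ?addr0// => i ij.
  by rewrite mxE (negbTE ij) andbF scale0r.
apply: (cl_is_derive_vecM (h := fun y => b y.1 (enorm y.2))).
  by move=> i; rewrite mxE eqxx /=; exact: is_derive_coord_dirv.
apply: cl_is_derive_radial_dirv => // S; under eq_fun do rewrite cl_coefZ.
apply: (is_derive_eq (is_derive_mulr (is_derive_invr r0) (prof_dr_B AB S Ux))).
rewrite /db /b cl_coefZ cl_coefD cl_coefN cl_coefZ cl_coefZ -/r -/s.
by have ? : r != 0 := lt0r_neq0 r0; field.
Qed.

Lemma partially_derivable_g : partially_derivable g x.
Proof.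
move=> S; split; first by have H := derive_g_dir0 S; exact: ex_derive.
by move=> j; have H := derive_g_dirv j S; exact: ex_derive.
Qed.

(** The terms in omega cancel because d_r A = - d_s B. What remains is d_s A - m b - r d_r b,
  where r d_r b = d_s A - (2 n + 1) b. *)
Lemma gen_CR_g : gen_CR g x = (2 * n%:R + 1 - m%:R) *: b s r.
Proof.
rewrite /gen_CR (cl_is_deriveE derive_g_dir0).
under eq_bigr => j _ do rewrite (cl_is_deriveE (derive_g_dirv j)) !mulrDr.
rewrite !big_split /=.
have -> : \sum_(j < m) cl_gen R j * ((x.2 0 j / r) *: - Bs s r) = - (w * (r^-1 *: Bs s r)).
  rewrite /w /cl_vec mulr_suml -sumrN; apply: eq_bigr => j _.
  by rewrite -scalerAl -!scalerAr mulrN scalerN scalerA.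
have -> : \sum_(j < m) cl_gen R j * (cl_gen R j * b s r) = - (m%:R *: b s r).
  under eq_bigr => j _ do rewrite mulrA cl_gen_sqr mulN1r.
  by rewrite sumr_const card_ord mulNrn scaler_nat.
have -> : \sum_(j < m) cl_gen R j * (w * ((x.2 0 j / r) *: db s r)) = - (r *: db s r).
  transitivity (w * w * (r^-1 *: db s r)).
    rewrite {2}/w /cl_vec !mulr_suml; apply: eq_bigr => j _.
    by rewrite -!scalerAl -!scalerAr !scalerA !mulrA.
  rewrite /w cl_vec_sqr -sqr_enorm -/r mulNr -scalerAl mul1r scalerA.
  by congr (- (_ *: _)); have ? : r != 0 := lt0r_neq0 r0; field.
have -> : r *: db s r = As s r - (2 * n%:R + 1) *: b s r.
  by rewrite /db scalerA mulfV ?(lt0r_neq0 r0)// scale1r.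
rewrite scalerBl.
have cancel (V : zmodType) (p q y z : V) : p + q + (- q + (- y - (p - z))) = z - y.
  by rewrite addrA addrK opprB addrCA [p + _]addrC subrK addrC.
exact: cancel.
Qed.

End AtPoint.
End MonogenicProfile.

(** * The Dunkl operators *)

(** The points x + t a with t nonzero leave the mirror, since <a, a> = 2. *)
Lemma off_mirror_proper {R : realType} {m : nat} (a : 'rV[R]_m) (x : paravec R m) :
  dotv a a = 2 -> dotv a x.2 = 0 -> ProperFilter (off_mirror a x).
Proof.
move=> a2 ax; split; last exact: within_filter.
rewrite /off_mirror /within /= => H.
have c : (x.1, x.2 + t *: a) @[t --> (0 : R)] --> x.
  have c1 : x.2 + t *: a @[t --> (0 : R)] --> x.2.
    rewrite -[X in _ --> X]addr0 -(scale0r a).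
    by apply: cvgD; [exact: cvg_cst|apply: cvgZr_tmp; exact: cvg_id].
  have c0 : (fun=> x.1) @ nbhs (0 : R) --> x.1 by exact: cvg_cst.
  rewrite [X in _ --> X]surjective_pairing.
  exact: (@cvg_pair _ _ _ _ _ _ _ _ _ _ _ c0 c1).
have /nbhs_ballP[e /= e0 eP] := c _ H.
apply: (eP (e / 2)) => /=; first by rewrite /ball /= sub0r normrN ger0_norm; lra.
by rewrite dotvDr dotvZr a2 ax add0r mulf_neq0// ?pnatr_eq0//; lra.
Qed.

Section DunklProfile.
Context {R : realType} {m : nat}.
Variables (n : nat) (U : set (R * R)) (A B As Bs : R -> R -> clifford R m).
Hypothesis U_open : open U.
Hypothesis U_pos : forall s r, U (s, r) -> 0 < r.
Hypothesis AB : profile n U A B As Bs.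
Variable g : paravec R m -> clifford R m.
Implicit Types (x y : paravec R m) (a : 'rV[R]_m).
Hypothesis gE : forall x, polar_dom U x ->
  g x = A x.1 (enorm x.2) + cl_vec x.2 * ((enorm x.2)^-1 *: B x.1 (enorm x.2)).

Let b x : clifford R m := (enorm x.2)^-1 *: B x.1 (enorm x.2).

(** A and b take the same value at x and at its reflection, and the vector parts differ by
  <a, x> a. *)
Lemma diff_quot_g a S x : dotv a a = 2 -> polar_dom U x -> dotv a x.2 != 0 ->
  diff_quot a (fun y => cl_coef S (g y)) x = cl_coef S (cl_vec a * b x).
Proof.
move=> a2 Ux ax; have Ux' : polar_dom U (preflect a x).
  by rewrite /polar_dom /preflect /= enorm_refl.
rewrite /diff_quot !gE// /preflect /= enorm_refl// refl_normalized// cl_vecB cl_vecZ.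
rewrite [(cl_vec x.2 - _) * _]mulrBl !cl_coefD cl_coefN -scalerAl cl_coefZ -/(b x).
by field.
Qed.

Lemma cvg_cl_coef_vecM a S x : polar_dom U x ->
  cl_coef S (cl_vec a * b y) @[y --> x] --> cl_coef S (cl_vec a * b x).
Proof.
move=> Ux; have r0 : enorm x.2 != 0 by rewrite gt_eqF// (U_pos Ux).
have cb T : cl_coef T (b y) @[y --> x] --> cl_coef T (b x).
  rewrite /b cl_coefZ; under eq_fun do rewrite cl_coefZ.
  have c2 : enorm y.2 @[y --> x] --> enorm x.2.
    have c : y.2 @[y --> x] --> x.2 by case: (x) => ? ?; exact: cvg_snd.
    exact: (cvg_comp _ _ c (@continuous_enorm R m _)).
  apply: cvgM; first exact: cvgV.
  exact: (cvg_comp _ _ (@cvg_paravec_polar R m x) (prof_cont_B AB Ux)).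
have E y : cl_coef S (cl_vec a * b y) = cl_coef S (cl_mul (cl_vec a) (b y)) by [].
rewrite E cl_mulE; under eq_fun do rewrite E cl_mulE.
apply: (@cvg_sumR _ _ _ (nbhs x)) => T.
by apply: cvgM; [exact: cvg_cst|apply: cvgM; [exact: cvg_cst|exact: cb]].
Qed.

Lemma cvg_diff_quot_g a S x : dotv a a = 2 -> polar_dom U x ->
  diff_quot a (fun y => cl_coef S (g y)) y @[y --> off_mirror a x] -->
    cl_coef S (cl_vec a * b x).
Proof.
move=> a2 Ux.
apply: cvg_trans (cvg_within_filter _ (cvg_cl_coef_vecM (a := a) (S := S) Ux)).
apply: near_eq_cvg; rewrite /off_mirror near_withinE.
apply: filterS (polar_dom_near U_open Ux) => y Uy ay.
by rewrite diff_quot_g.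
Qed.

Lemma diff_quot_ext_g a S x : dotv a a = 2 -> polar_dom U x ->
  diff_quot_ext a (fun y => cl_coef S (g y)) x = cl_coef S (cl_vec a * b x).
Proof.
move=> a2 Ux; rewrite /diff_quot_ext; case: eqP => [ax|/eqP ax]; last exact: diff_quot_g.
have ? := off_mirror_proper a2 ax.
apply: cvg_lim => //; exact: cvg_diff_quot_g.
Qed.

(** For each root a, sum_j e_j (a_j a b) = a^2 b = - 2 b. *)
Lemma dunkl_CR_g (P : {fset 'rV[R]_m}) k x : (forall a, a \in P -> dotv a a = 2) ->
  polar_dom U x ->
  dunkl_CR P k g x = (2 * n%:R + 1 - m%:R - 2 * gamma_k P k) *: b x.
Proof.
move=> P2 Ux.
transitivity (gen_CR g x + \sum_(j < m) cl_gen R j *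
    \sum_(a <- P) (k a * a 0 j) *: (cl_vec a * b x)).
  rewrite /dunkl_CR /gen_CR -addrA -big_split /=; congr (_ + _); apply: eq_bigr => j _.
  rewrite -mulrDr; congr (_ * _); apply: cl_coefP => S.
  rewrite cl_coefD /cwise !cl_mkE /dunkl; congr (_ + _).
  have -> : cl_coef S (\sum_(a <- P) (k a * a 0 j) *: (cl_vec a * b x)) =
      \sum_(a <- P) cl_coef S ((k a * a 0 j) *: (cl_vec a * b x)).
    apply: (big_morph (@cl_coef R m S)); first by move=> *; exact: cl_coefD.
    by rewrite /cl_coef ffunE.
  apply: eq_big_seq => a aP; rewrite diff_quot_ext_g ?P2// cl_coefZ.
  by rewrite mulrAC.
rewrite (gen_CR_g U_open U_pos AB gE Ux) -/(b x) [RHS]scalerBl; congr (_ + _).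
under eq_bigr => j _ do rewrite mulr_sumr.
rewrite exchange_big /= /gamma_k mulr_sumr scaler_suml -sumrN.
apply: eq_big_seq => a aP.
transitivity (k a *: (cl_vec a * cl_vec a * b x)); last first.
  by rewrite cl_vec_sqr P2// mulNr -scalerAl mul1r scalerN scalerA mulrC.
rewrite {2}/cl_vec -mulrA [in RHS]mulr_suml scaler_sumr; apply: eq_bigr => j _.
by rewrite -scalerAr -scalerAl scalerA.
Qed.

Lemma in_ker_dunkl_CR_g (P : {fset 'rV[R]_m}) k (X : set (paravec R m)) :
  (forall a, a \in P -> dotv a a = 2) -> X `<=` polar_dom U ->
  2 * gamma_k P k = 2 * n%:R + 1 - m%:R ->
  in_ker_dunkl_CR P k X g.
Proof.
move=> P2 XU gk x /XU Ux; split.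
- exact: (partially_derivable_g U_open U_pos AB gE Ux).
- move=> a aP ax S; apply/cvg_ex; eexists.
  exact: cvg_diff_quot_g (P2 _ aP) Ux.
- by rewrite dunkl_CR_g// gk subrr scale0r.
Qed.

Lemma in_ker_gen_CR_g (X : set (paravec R m)) : X `<=` polar_dom U ->
  2 * n%:R + 1 - m%:R = 0 :> R -> in_ker_gen_CR X g.
Proof.
move=> XU nm x /XU Ux; split; first exact: (partially_derivable_g U_open U_pos AB gE Ux).
by rewrite (gen_CR_g U_open U_pos AB gE Ux) nm scale0r.
Qed.

End DunklProfile.

Theorem theorem4p4 (R : realType) (m : nat) (m_gt0 : (0 < m)%N)
    (D : set (R * R)) (D_open : open D) (D_sym : conj_symmetric D)
    (f : paravec R m -> clifford R m) (alpha beta : R * R -> clifford R m)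
    (f_sr : slice_regular D alpha beta f) :
  (forall (n : nat) (RS P : {fset 'rV[R]_m}) (k : 'rV[R]_m -> R),
      root_system RS -> normalized RS -> positive_subsystem RS P ->
      multiplicity RS k -> ~ K_sing P k ->
      gamma_k P k = n%:R + (1 - m%:R) / 2 ->
      in_ker_dunkl_CR P k (Omega D `\` real_line R m) (Vn n alpha beta)) /\
  (forall (RS P : {fset 'rV[R]_m}) (k : 'rV[R]_m -> R),
      root_system RS -> normalized RS -> positive_subsystem RS P ->
      multiplicity RS k -> (forall a, a \in RS -> 0 < k a) ->
      (exists N : nat, gamma_k P k + (m%:R - 1) / 2 = N%:R) ->
      forall n : nat,
        (n%:R = (m%:R - 1) / 2 :> R ->
          in_ker_gen_CR (Omega D `\` real_line R m) (Vn n alpha beta)) /\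
        (n%:R = gamma_k P k + (m%:R - 1) / 2 ->
          in_ker_dunkl_CR P k (Omega D `\` real_line R m) (Vn n alpha beta))).
Proof.
have [_ hol _] := f_sr.
pose U := [set z : R * R | D z /\ 0 < z.2].
have U_open : open U by exact: open_upper_half.
have U_pos s r : U (s, r) -> 0 < r by case.
have XU : Omega D `\` real_line R m `<=` polar_dom U.
  move=> x [[s [t [w [Dst w1 ->]]]] /= x0].
  rewrite /polar_dom /U /= enormZ w1 mulr1; split; last first.
    by rewrite normr_gt0; apply: contra_notN x0 => /eqP ->; rewrite /real_line /= scale0r.
  by case: (lerP 0 t) => ht; [rewrite ger0_norm|rewrite ltr0_norm//; exact: (D_sym _ Dst)].
have main (n : nat) : exists A B As Bs, profile n U A B As Bs /\
    forall x, polar_dom U x -> Vn n alpha beta x =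
      A x.1 (enorm x.2) + cl_vec x.2 * ((enorm x.2)^-1 *: B x.1 (enorm x.2)).
  have [A [B [As [Bs [AB E]]]]] := slice_profile D_open hol n.
  exists A, B, As, Bs; split => // x [Dx /= r0]; have [E1 E2] := E _ _ Dx r0.
  by rewrite /Vn E1 E2 /cl_dir cl_vecZ -scalerAl scalerAr.
have norm2 (RS P : {fset 'rV[R]_m}) : normalized RS -> positive_subsystem RS P ->
    forall a, a \in P -> dotv a a = 2.
  by move=> nRS [PRS _ _] a aP; apply: nRS; rewrite -PRS in_fsetU aP.
split=> [n RS P k _ nRS pos _ _ gk|RS P k _ nRS pos _ _ _ n].
  have [A [B [As [Bs [AB gE]]]]] := main n.
  apply: (in_ker_dunkl_CR_g U_open U_pos AB gE) => //; first exact: norm2 nRS pos.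
  by rewrite gk; field.
have [A [B [As [Bs [AB gE]]]]] := main n.
split=> [nE|nE].
  apply: (in_ker_gen_CR_g U_open U_pos AB gE) => //.
  by rewrite nE; field.
apply: (in_ker_dunkl_CR_g U_open U_pos AB gE) => //; first exact: norm2 nRS pos.
by rewrite nE; field.
Qed.
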